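(* Let $\omega$ be a smooth, closed, positive $(1,1)$-form on $\mathbb{R}^n$ (in the sense of super forms) and let $\varphi$ be a smooth real-valued function on $\mathbb{R}^n$. For every smooth, compactly supported form $\alpha$, $$\|d^{*}\alpha\|_{\varphi}^{2}+\|d\alpha\|_{\varphi}^{2}=\|(d_{\varphi}^{\#})^{*}\alpha\|_{\varphi}^{2}+\|d_{\varphi}^{\#}\alpha\|_{\varphi}^{2}+\left\langle [dd^{\#}\varphi,\Lambda]\alpha,\alpha\right\rangle _{\varphi}.$$
   Context: Super forms: on $\mathbb{R}^n\times\mathbb{R}^n$ with coordinates $(x_1,\dots,x_n,\xi_1,\dots,\xi_n)$, a $(p,q)$-form is $\alpha=\sum_{|I|=p,|J|=q}\alpha_{IJ}(x)\,dx_I\wedge d\xi_J$ with real coefficients depending only on $x$. It is smooth (compactly supported) if its coefficients are smooth (compactly supported) functions on $\mathbb{R}^n$. Set $d\alpha=\sum_i dx_i\wedge\partial_{x_i}\alpha$ and $d^{\#}\alpha=\sum_i d\xi_i\wedge\partial_{x_i}\alpha$, where $\partial_{x_i}$ acts on coefficients. $J$ is the linear map with $J(\alpha_{IJ}dx_I\wedge d\xi_J)=\alpha_{IJ}d\xi_I\wedge dx_J$. A form $\alpha$ is closed if $d\alpha=0$. A smooth $(1,1)$-form $\omega=\sum\omega_{ij}dx_i\wedge d\xi_j$ is positive if the matrix $(\omega_{ij}(x))$ is (symmetric) positive definite for each $x$. Metric: $\omega$ induces at each $x$ the inner product on $(1,0)$-forms $(\sum a_idx_i,\sum b_jdx_j)=\sum\omega^{ij}(x)a_ib_j$,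 $(\omega^{ij})=(\omega_{ij})^{-1}$. If $e_1,\dots,e_n$ is an orthonormal basis of $(1,0)$-forms at $x$ and $\epsilon_i=J(e_i)$, the inner product $(\cdot,\cdot)$ on $(p,q)$-forms at $x$ is the one for which the forms $e_I\wedge\epsilon_J$ are orthonormal (independent of choices); forms of different bidegree are orthogonal; $|\alpha|^2=(\alpha,\alpha)$. $L\alpha=\omega\wedge\alpha$ and $\Lambda$ is its pointwise adjoint: $(L\alpha,\beta)=(\alpha,\Lambda\beta)$. Integration: $\int_{\mathbb{R}^n\times\mathbb{R}^n}\alpha_0(x)\,dx_1\wedge d\xi_1\wedge\dots\wedge dx_n\wedge d\xi_n=\int_{\mathbb{R}^n}\alpha_0(x)\,dx$; $\omega_n=\omega^n/n!$. Put $\langle\alpha,\beta\rangle_\varphi=\int_{\mathbb{R}^n\times\mathbb{R}^n}(\alpha,\beta)e^{-\varphi}\omega_n$ and $\|\alpha\|_\varphi^2=\langle\alpha,\alpha\rangle_\varphi$. Operators: $d^{\#}_\varphi\alpha=e^{\varphi}d^{\#}(e^{-\varphi}\alpha)$; $d^*$ and $(d^{\#}_\varphi)^*$ denote the adjoints of $d$ and $d^{\#}_\varphi$ with respect to $\langle\cdot,\cdot\rangle_\varphi$. In the commutator, $dd^{\#}\varphi$ denotes the operator $\alpha\mapsto dd^{\#}\varphi\wedge\alpha$, so $[dd^{\#}\varphi,\Lambda]\alpha=dd^{\#}\varphi\wedge\Lambda\alpha-\Lambda(dd^{\#}\varphi\wedge\alpha)$. *)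

(* Defs.v *)
From HB Require Import structures.
From mathcomp Require Import all_boot all_order all_algebra.
From mathcomp Require Import all_classical all_reals all_analysis.

Set Implicit Arguments.
Unset Strict Implicit.
Unset Printing Implicit Defensive.

Import Order.TTheory GRing.Theory Num.Theory.
Import numFieldNormedType.Exports.

Local Open Scope classical_set_scope.
Local Open Scope ring_scope.

Section tuple_measure.
Context d (T : measurableType d) (R : realType) (n : nat).
Variables (m1 : {sigma_finite_measure set T -> \bar R})
          (m2 : {sigma_finite_measure set (n.-tuple T) -> \bar R}).

Definition tuple_cons (p : T * n.-tuple T) : n.+1.-tuple T :=
  [tuple of p.1 :: p.2].

Lemma measurable_tuple_cons : measurable_fun setT tuple_cons.
Proof. exact: measurable_cons. Qed.

Definition tuple_measure : set (n.+1.-tuple T) -> \bar R :=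
  pushforward (m1 \x m2)%E tuple_cons.

Let measurable_pre (A : set (n.+1.-tuple T)) :
  measurable A -> measurable (tuple_cons @^-1` A).
Proof.
by move=> mA; rewrite -[X in measurable X]setTI; exact: measurable_tuple_cons.
Qed.

Let tuple_measure0 : tuple_measure set0 = 0%E.
Proof. by rewrite /tuple_measure /pushforward preimage_set0 measure0. Qed.

Let tuple_measure_ge0 A : (0 <= tuple_measure A)%E.
Proof. by rewrite /tuple_measure /pushforward; exact: measure_ge0. Qed.

Let tuple_measure_sigma_additive : semi_sigma_additive tuple_measure.
Proof.
move=> F mF tF mUF; rewrite /tuple_measure /pushforward preimage_bigcup.
apply: measure_semi_sigma_additive.
- by move=> k; exact: measurable_pre.
- apply/trivIsetP => /= i j _ _ ij; rewrite -preimage_setI.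
  by move/trivIsetP : tF => /(_ _ _ _ _ ij) ->//; rewrite preimage_set0.
- by rewrite -preimage_bigcup; exact: measurable_pre.
Qed.

HB.instance Definition _ := isMeasure.Build _ _ _ tuple_measure
  tuple_measure0 tuple_measure_ge0 tuple_measure_sigma_additive.

Let tuple_measure_sigma_finite : sigma_finite setT tuple_measure.
Proof.
have /sigma_finiteP[F [TF ndF Foo]] := sigma_finiteT m1.
have /sigma_finiteP[G [TG ndG Goo]] := sigma_finiteT m2.
pose g (t : n.+1.-tuple T) : T * n.-tuple T :=
  (tnth t ord0, [tuple of behead t]).
have mg : measurable_fun setT g.
  apply: measurable_fun_pair; first exact: measurable_tnth.
  exact: measurable_behead.
have gK : cancel tuple_cons g.
  by case=> x t; rewrite /g /tuple_cons/=; congr pair; exact/val_inj.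
exists (fun k => g @^-1` (F k `*` G k)).
  apply/esym; rewrite -subTset => t _.
  have [i _ Fi] : (\bigcup_i F i) (g t).1 by rewrite -TF.
  have [j _ Gj] : (\bigcup_i G i) (g t).2 by rewrite -TG.
  exists (maxn i j) => //; split.
    by move: Fi; exact/subsetPset/ndF/leq_maxl.
  by move: Gj; exact/subsetPset/ndG/leq_maxr.
move=> k; have [mF Fk] := Foo k; have [mG Gk] := Goo k; split.
  by rewrite -[X in measurable X]setTI; apply: mg => //; exact: measurableX.
rewrite /tuple_measure /pushforward -comp_preimage.
have -> : g \o tuple_cons = id by apply/funext => p /=; rewrite gK.
by rewrite preimage_id product_measure1E// lte_mul_pinfty// ge0_fin_numE.
Qed.

HB.instance Definition _ := Measure_isSigmaFinite.Build _ _ _ tuple_measure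
  tuple_measure_sigma_finite.

End tuple_measure.

(* Lebesgue measure on R^n, the n-fold product of the one-dimensional one; the
   tuples carry the product sigma-algebra, while points of R^n are row vectors
   elsewhere. *)
Fixpoint lebesgue_tuple (R : realType) (n : nat) :
    {sigma_finite_measure set (n.-tuple (measurableTypeR R)) -> \bar R} :=
  match n with
  | 0%N => \d_[tuple]
  | m.+1 => tuple_measure (@lebesgue_measure R) (lebesgue_tuple R m)
  end.

Definition integral_Rn (R : realType) (n : nat) (f : 'rV[R]_n -> R) : R :=
  \int[lebesgue_tuple R n]_t f (\row_i tnth t i).

Section smooth.
Context (R : realType) (n : nat).
Implicit Types f : 'rV[R]_n -> R.

Definition partial (i : 'I_n) f : 'rV[R]_n -> R :=
  fun x => 'D_(delta_mx 0 i) f x.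

Definition partials (s : seq 'I_n) f : 'rV[R]_n -> R := foldr partial f s.

Definition smooth f := forall s : seq 'I_n,
  (forall i x, derivable (partials s f) x (delta_mx 0 i)) /\
  continuous (partials s f).

Definition compactly_supported f := compact (closure [set x | f x != 0]).

End smooth.

(* The adjoint, with respect to the pairing ip, of an operator A on the domain
   P; the value at b is unique as soon as ip is positive definite on P. *)
Definition adjoint (R : realType) (V : choiceType) (P : set V)
    (ip : V -> V -> R) (A : V -> V) (b : V) : V :=
  xget b [set c | P c /\ forall a, P a -> ip (A a) b = ip a c].

Section superforms.
Context (R : realType) (n : nat).
Local Open Scope set_scope.

(* Super forms at a point: u (I, K) is the coefficient of dx_I /\ dxi_K, the
   factors of dx_I and dxi_K being taken in increasing order. *)
Definition ext := {ffun {set 'I_n} * {set 'I_n} -> R}.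

Definition ext_basis (S : {set 'I_n} * {set 'I_n}) : ext :=
  [ffun T => (T == S)%:R].

Definition inversions (I K : {set 'I_n}) : nat :=
  #|[set p : 'I_n * 'I_n | [&& p.1 \in I, p.2 \in K & (p.2 < p.1)%N]]|.

(* (dx_I1 /\ dxi_K1) /\ (dx_I2 /\ dxi_K2) vanishes unless I1, I2 are disjoint
   and K1, K2 are disjoint; the exponent counts the transpositions that bring
   it to the form +/- dx_(I1 U I2) /\ dxi_(K1 U K2). *)
Definition wedge (u v : ext) : ext := [ffun S =>
  \sum_(I in powerset S.1) \sum_(K in powerset S.2)
    (-1) ^+ (#|K| * #|S.1 :\: I| + inversions I (S.1 :\: I)
             + inversions K (S.2 :\: K))
    * u (I, K) * v (S.1 :\: I, S.2 :\: K)].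

Definition ext_one : ext := ext_basis (finset.set0, finset.set0).
Definition dx (i : 'I_n) : ext := ext_basis ([set i], finset.set0).
Definition dxi (i : 'I_n) : ext := ext_basis (finset.set0, [set i]).

Definition J (u : ext) : ext :=
  \sum_S u S *: wedge (ext_basis (finset.set0, S.1))
                      (ext_basis (S.2, finset.set0)).

Definition form1 (a : 'rV[R]_n) : ext := \sum_i a 0 i *: dx i.

Definition wedge_set (e : 'I_n -> ext) (I : {set 'I_n}) : ext :=
  \big[wedge/ext_one]_(i <- enum I) e i.

(* In the next definitions W is the matrix (omega_ij) at the given point. *)
Definition ip1 (W : 'M[R]_n) (a b : 'rV[R]_n) : R :=
  \sum_i \sum_j (invmx W) i j * a 0 i * b 0 j.

Definition orthonormal_frame (W : 'M[R]_n) (e : 'I_n -> 'rV[R]_n) :=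
  forall i j, ip1 W (e i) (e j) = (i == j)%:R.

Definition frame (e : 'I_n -> 'rV[R]_n) (S : {set 'I_n} * {set 'I_n}) : ext :=
  wedge (wedge_set (fun i => form1 (e i)) S.1)
        (wedge_set (fun i => J (form1 (e i))) S.2).

Definition inner_product (ip : ext -> ext -> R) :=
  [/\ forall a u v w, ip (a *: u + v) w = a * ip u w + ip v w,
      forall u v, ip u v = ip v u &
      forall u, u != 0 -> 0 < ip u u].

Definition induced_inner_product (W : 'M[R]_n) (ip : ext -> ext -> R) :=
  inner_product ip /\
  forall e, orthonormal_frame W e ->
    forall S T, ip (frame e S) (frame e T) = (S == T)%:R.

(* For positive definite W exactly one map ip satisfies the condition. *)
Definition super_ip (W : 'M[R]_n) : ext -> ext -> R :=
  xget (fun _ _ => 0) [set ip | induced_inner_product W ip]%classic.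

Definition superform := 'rV[R]_n -> ext.
Implicit Types alpha beta omega : superform.

Definition bidegree (p q : nat) alpha :=
  forall x (S : {set 'I_n} * {set 'I_n}),
    (#|S.1|, #|S.2|) != (p, q) -> alpha x S = 0.

Definition smooth_form alpha := forall S, smooth (fun x => alpha x S).

Definition test_form alpha :=
  smooth_form alpha /\
  forall S, compactly_supported (fun x => alpha x S).

Definition partial_form (i : 'I_n) alpha : superform :=
  fun x => [ffun S => partial i (fun y => alpha y S) x].

Definition ext_d alpha : superform :=
  fun x => \sum_i wedge (dx i) (partial_form i alpha x).

Definition ext_dsharp alpha : superform :=
  fun x => \sum_i wedge (dxi i) (partial_form i alpha x).

Definition closed_form alpha := forall x, ext_d alpha x = 0.

Definition wedge_form alpha beta : superform :=
  fun x => wedge (alpha x) (beta x).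

Definition scale_form (f : 'rV[R]_n -> R) alpha : superform :=
  fun x => f x *: alpha x.

Definition form0 (f : 'rV[R]_n -> R) : superform := fun x => f x *: ext_one.

Definition coef11 omega (x : 'rV[R]_n) : 'M[R]_n :=
  \matrix_(i, j) omega x ([set i], [set j]).

Definition positive11 omega := forall x,
  (coef11 omega x)^T = coef11 omega x /\
  forall v : 'rV[R]_n, v != 0 -> 0 < (v *m coef11 omega x *m v^T) 0 0.

(* dx_1 /\ dxi_1 /\ ... /\ dx_n /\ dxi_n, which is +/- dx_[n] /\ dxi_[n] *)
Definition vol : ext :=
  \big[wedge/ext_one]_(i <- enum 'I_n) wedge (dx i) (dxi i).

(* The quotient is the coefficient alpha_0 of the top-degree part of alpha,
   written alpha_0 *: vol. *)
Definition super_integral alpha : R :=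
  integral_Rn (fun x =>
    alpha x (finset.setT, finset.setT) / vol (finset.setT, finset.setT)).

Definition omega_n omega : superform :=
  fun x => (n`!)%:R^-1 *: iter n (wedge (omega x)) ext_one.

Section weighted.
Variables (omega : superform) (phi : 'rV[R]_n -> R).

Definition form_ip alpha beta : 'rV[R]_n -> R :=
  fun x => super_ip (coef11 omega x) (alpha x) (beta x).

Definition dotp alpha beta : R := super_integral
  (scale_form (fun x => form_ip alpha beta x * expR (- phi x)) (omega_n omega)).

Definition normsq alpha : R := dotp alpha alpha.

Definition Lambda alpha : superform := fun x =>
  adjoint setT (super_ip (coef11 omega x)) (wedge (omega x)) (alpha x).

Definition dsharp_phi alpha : superform :=
  scale_form (fun x => expR (phi x))
    (ext_dsharp (scale_form (fun x => expR (- phi x)) alpha)).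

(* Adjoint on the space of smooth compactly supported forms. *)
Definition form_adjoint (A : superform -> superform) : superform -> superform :=
  adjoint [set alpha | test_form alpha]%classic dotp A.

Definition commutator_Lambda (eta alpha : superform) : superform := fun x =>
  wedge_form eta (Lambda alpha) x - Lambda (wedge_form eta alpha) x.

End weighted.

Definition ddsharp (phi : 'rV[R]_n -> R) : superform :=
  ext_d (ext_dsharp (form0 phi)).

End superforms.

(* Main.v *)
From HB Require Import structures.
Require Import Defs.
From mathcomp Require Import all_boot all_order all_algebra.
From mathcomp Require Import all_classical all_reals all_analysis.
From mathcomp Require Import measurable_realfun.
From mathcomp Require Import ring.

Set Implicit Arguments.
Unset Strict Implicit.
Unset Printing Implicit Defensive.

Import Order.TTheory GRing.Theory Num.Theory.
Import numFieldNormedType.Exports.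

Local Open Scope ring_scope.

(** Write a_i and b_i for exterior multiplication by dx_i and dxi_i, W for the
    matrix of omega, M for its inverse, and A_i, B_i for the contractions dual
    to a_i, b_i. All these operators anticommute up to constants, and for the
    inner product defined by omega the adjoint of a_i is sum_k M_ik A_k, and
    similarly for b_i (super_ip_spec). Hence Lambda = sum_jk M_jk B_k A_j
    (LambdaE), and everything about the metric is reduced to the canonical
    anticommutation relations.

    The heart of the proof is the pair of Kaehler identities: for the pairing
    without weight, the adjoint of d is the commutator Lambda d# - d# Lambda,
    and the adjoint of d# is d Lambda - Lambda d. Both are codiff_adjoint, with
    a boolean that exchanges dx and dxi. To prove it, differentiate the function
    (a_i alpha, beta) vol in direction i and sum over i. The inner product varies
    by a derivation of the exterior algebra (super_ip_derivative) and the volume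
    density by a trace (partial_volume), so the sum is (d alpha, beta) vol
    minus (alpha, gamma) vol, where gamma is explicit. The commutator with
    Lambda gives the same first-order terms as gamma; the zero-order terms agree
    because a closed omega has first derivatives symmetric in all three indices
    (dmetric_sym, kaehler_zero_order). A divergence with compact support has
    integral zero (integral_Rn_partial), and the identity follows.

    The weight is then a conjugation: for the pairing with weight, the adjoint
    of d is the commutator of Lambda with the twisted operator d#_phi, while the
    adjoint of d#_phi is still d Lambda - Lambda d (ext_d_adjoint,
    dsharp_phi_adjoint). Expanding the Laplacians of d and of d#_phi, all terms of
    the difference cancel except the commutator of Lambda with the
    anticommutator of d and d#_phi (laplacian_commutator). Since mixed partial
    derivatives commute, this anticommutator is multiplication by - dd# phi
    (super_d_dsharp_phi), which yields the commutator of the statement.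
    Integrating the equality of Laplacians against alpha gives the theorem. *)

(** * Creation and contraction operators *)

Lemma scaleRE (R : realType) (a b : R) : a *: b = a * b.
Proof. by []. Qed.

Section modes.
Context {R : realType} {n : nat}.
Local Open Scope set_scope.
Implicit Types (p q : bool * 'I_n) (S T : {set 'I_n} * {set 'I_n}).
Implicit Types u v : ext R n.

(** A mode (b, i) stands for dx_i if b is false and for dxi_i if b is true.
    With all dx placed before all dxi, dx_I /\ dxi_K is an ordered product of
    modes, and both kinds of generators obey the same rules. *)
Definition occ S p : bool := p.2 \in (if p.1 then S.2 else S.1).

(** Toggling is an involution, so that one formula covers both the insertion
    and the removal of a generator. *)
Definition flip p S : {set 'I_n} * {set 'I_n} :=
  ([set j | (j \in S.1) (+) ((false, j) == p)],
   [set j | (j \in S.2) (+) ((true, j) == p)]).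

Definition before q p : bool :=
  (~~ q.1 && p.1) || ((q.1 == p.1) && (q.2 < p.2)%N).

(** The sign of moving the generator p to its place among the factors of S. *)
Definition mode_sign p S : R := \prod_(q | before q p) (-1) ^+ occ S q.

Lemma occ_inj S T : occ S =1 occ T -> S = T.
Proof.
move: S T => [A B] [C D] h; congr pair; apply/setP => i.
  by have := h (false, i).
by have := h (true, i).
Qed.

Lemma occ_flip p S q : occ (flip p S) q = occ S q (+) (q == p).
Proof. by move: q => [[] i]; rewrite /occ /flip /= inE. Qed.

Lemma flipK p : involutive (flip p).
Proof. by move=> S; apply: occ_inj => q; rewrite !occ_flip -addbA addbb addbF. Qed.

Lemma flipC p q S : flip p (flip q S) = flip q (flip p S).
Proof. by apply: occ_inj => r; rewrite !occ_flip -!addbA [(r == q) (+) _]addbC. Qed.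

Lemma before_irr p : before p p = false.
Proof. by rewrite /before ltnn andbF; case: p.1. Qed.

Lemma before_total p q : p != q -> before q p = ~~ before p q.
Proof.
move: p q => [b i] [c j]; rewrite /before /= -pair_eqE /pair_eq /=.
case: b c => [] [] //=; rewrite ltnNge leq_eqVlt => /negPf.
all: by rewrite -val_eqE /= eq_sym => /negbT/negPf; rewrite eq_sym => ->.
Qed.

Lemma mode_sign_flip p q S : mode_sign p (flip q S) = (-1) ^+ before q p * mode_sign p S.
Proof.
rewrite /mode_sign; under eq_bigr do rewrite occ_flip signr_addb.
rewrite big_split /= mulrC; congr (_ * _).
case hqp: (before q p).
  rewrite (bigD1 q) //= eqxx big1 ?mulr1 // => r /andP[_ /negPf ->].
  by rewrite expr0.
rewrite big1 // => r hr; case: eqP => [erq|]; last by rewrite expr0.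
by move: hr; rewrite erq hqp.
Qed.

Lemma mode_sign_sqr p S : mode_sign p S * mode_sign p S = 1.
Proof.
rewrite /mode_sign -big_split /= big1 // => q _.
by rewrite -signr_addb addbb expr0.
Qed.

(** The fermionic creation and annihilation operators: exterior multiplication
    by a generator, and interior product with the dual vector. *)
Definition creation p u : ext R n :=
  [ffun S => (occ S p)%:R * mode_sign p S * u (flip p S)].
Definition contraction p u : ext R n :=
  [ffun S => (~~ occ S p)%:R * mode_sign p S * u (flip p S)].
Definition vac u : R := u (finset.set0, finset.set0).

Lemma creation_is_linear p : linear (creation p).
Proof.
move=> a u v; apply/ffunP => S; rewrite !ffunE [LHS]mulrDr; congr (_ + _); exact: mulrCA.
Qed.
HB.instance Definition _ p := GRing.isLinear.Build R (ext R n) (ext R n) _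
  (creation p) (creation_is_linear p).

Lemma contraction_is_linear p : linear (contraction p).
Proof. move=> a u v; apply/ffunP => S; rewrite !ffunE [LHS]mulrDr; congr (_ + _); exact: mulrCA. Qed.
HB.instance Definition _ p := GRing.isLinear.Build R (ext R n) (ext R n) _
  (contraction p) (contraction_is_linear p).

Lemma creationD p u v : creation p (u + v) = creation p u + creation p v.
Proof. exact: linearD. Qed.
Lemma creationN p u : creation p (- u) = - creation p u.
Proof. exact: linearN. Qed.
Lemma creationZ p k u : creation p (k *: u) = k *: creation p u.
Proof. exact: linearZ. Qed.
Lemma creation0 p : creation p 0 = 0.
Proof. exact: linear0. Qed.
Lemma creation_sum p (I : Type) (r : seq I) (P : pred I) (F : I -> ext R n) :
  creation p (\sum_(i <- r | P i) F i) = \sum_(i <- r | P i) creation p (F i).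
Proof. exact: linear_sum. Qed.

Lemma contractionD p u v : contraction p (u + v) = contraction p u + contraction p v.
Proof. exact: linearD. Qed.
Lemma contractionN p u : contraction p (- u) = - contraction p u.
Proof. exact: linearN. Qed.
Lemma contractionZ p k u : contraction p (k *: u) = k *: contraction p u.
Proof. exact: linearZ. Qed.
Lemma contraction0 p : contraction p 0 = 0.
Proof. exact: linear0. Qed.
Lemma contraction_sum p (I : Type) (r : seq I) (P : pred I) (F : I -> ext R n) :
  contraction p (\sum_(i <- r | P i) F i) = \sum_(i <- r | P i) contraction p (F i).
Proof. exact: linear_sum. Qed.

Lemma vac_is_linear : linear_for *%R vac.
Proof. by move=> a u v; rewrite /vac !ffunE. Qed.
HB.instance Definition _ := GRing.isLinear.Build R (ext R n) R _
  vac vac_is_linear.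

Lemma creationC p q u :
  creation p (creation q u) = - creation q (creation p u).
Proof.
apply/ffunP => S; rewrite !ffunE !occ_flip !mode_sign_flip (flipC p q).
have [->|npq] := eqVneq p q.
  by rewrite ?eqxx addbT; case: (occ S q); rewrite /= ?(mul0r, mulr0, oppr0).
rewrite ?(negPf npq) ?[q == p]eq_sym ?(negPf npq) !addbF (before_total npq).
by case: (before p q) => /=; rewrite ?expr0 ?expr1; ring.
Qed.

Lemma contractionC p q u :
  contraction p (contraction q u) = - contraction q (contraction p u).
Proof.
apply/ffunP => S; rewrite !ffunE !occ_flip !mode_sign_flip (flipC p q).
have [->|npq] := eqVneq p q.
  by rewrite ?eqxx addbT; case: (occ S q); rewrite /= ?(mul0r, mulr0, oppr0).
rewrite ?(negPf npq) ?[q == p]eq_sym ?(negPf npq) !addbF (before_total npq).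
by case: (before p q) => /=; rewrite ?expr0 ?expr1; ring.
Qed.

(** The canonical anticommutation relation. With creationC and contractionC it
    encodes all the signs that the metric computations meet. *)
Lemma contraction_creation p q u :
  contraction p (creation q u) = (p == q)%:R *: u - creation q (contraction p u).
Proof.
apply/ffunP => S; rewrite !ffunE !occ_flip !mode_sign_flip (flipC p q).
have [->|npq] := eqVneq p q.
  rewrite ?eqxx addbT before_irr flipK expr0 mul1r.
  have hs := mode_sign_sqr q S; set s := mode_sign q S in hs *.
  by case: (occ S q); rewrite /= !mul0r !mul1r scale1r mulrA hs mul1r ?subrr ?subr0.
rewrite ?(negPf npq) ?[q == p]eq_sym ?(negPf npq) !addbF (before_total npq).
by case: (before p q) => /=; rewrite scale0r ?expr0 ?expr1; ring.
Qed.

Lemma vac_creation p u : vac (creation p u) = 0.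
Proof. by rewrite /vac !ffunE /occ /= if_same inE !mul0r. Qed.

Lemma contraction_one p : contraction p (ext_one R n) = 0.
Proof.
apply/ffunP => S; rewrite !ffunE.
case h: (occ S p); rewrite /= ?mul0r //.
case: eqP => [e|]; last by rewrite mulr0.
have := occ_flip p S p; rewrite h eqxx e /occ /=.
by rewrite if_same inE.
Qed.

Lemma vac_one : vac (ext_one R n) = 1.
Proof. by rewrite /vac ffunE eqxx. Qed.

Lemma occ0 S : (forall p, ~~ occ S p) -> S = (finset.set0, finset.set0).
Proof.
move=> h; apply: occ_inj => p; rewrite (negPf (h p)) /occ /=.
by rewrite if_same inE.
Qed.

(** A coefficient at a nonempty S reappears, up to sign, in the contraction by
    any mode of S. *)
Lemma vacuum_unique u : (forall p, contraction p u = 0) ->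
  u = vac u *: ext_one R n.
Proof.
move=> h; apply/ffunP => S; rewrite !ffunE.
have [->|nS] := eqVneq S (finset.set0, finset.set0); first by rewrite [RHS]mulr1.
rewrite [RHS]mulr0.
have [p Sp] : exists p, occ S p.
  apply/existsP; apply: contraNT nS; rewrite negb_exists => /forallP hS.
  by rewrite (occ0 hS).
have /ffunP/(_ (flip p S)) := h p.
rewrite !ffunE occ_flip Sp eqxx /= mul1r flipK mode_sign_flip before_irr expr0 mul1r.
by move/(congr1 (fun z => mode_sign p S * z)); rewrite mulrA mode_sign_sqr mul1r mulr0.
Qed.

Lemma ext_basisE u : u = \sum_S u S *: ext_basis R S.
Proof.
apply/ffunP => T; rewrite sum_ffunE (bigD1 T) //= big1 ?addr0 => [|S nST].
  by rewrite !ffunE eqxx [RHS]mulr1.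
by rewrite !ffunE eq_sym (negPf nST) [LHS]mulr0.
Qed.

Lemma ext_basis_creation S p : occ S p ->
  ext_basis R S = mode_sign p S *: creation p (ext_basis R (flip p S)).
Proof.
move=> Sp; apply/ffunP => T; rewrite !ffunE (inj_eq (inv_inj (flipK p))).
case: eqP => [->|_]; last by rewrite [_ * 0]mulr0 [RHS]mulr0.
by rewrite Sp mulr1 mul1r [RHS]mode_sign_sqr.
Qed.

(** Forms are spanned by products of creation operators applied to 1, so a
    linear statement about forms only has to be carried across one creation
    operator. *)
Lemma ext_ind (P : ext R n -> Prop) :
  (forall a u v, P u -> P v -> P (a *: u + v)) ->
  P (ext_one R n) -> (forall p u, P u -> P (creation p u)) -> forall u, P u.
Proof.
move=> Plin P1 Pc.
have P0 : P 0 by have := Plin (-1) _ _ P1 P1; rewrite scaleN1r addNr.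
have Pb S : P (ext_basis R S).
  move: {-1}(#|[set p | occ S p]|) (leqnn #|[set p | occ S p]|) => m.
  elim: m S => [|m IH] S hm.
    rewrite [S]occ0 // => p; apply/negP => hp.
    by move: hm; rewrite leqn0 cards_eq0 => /eqP/setP/(_ p); rewrite !inE hp.
  have [/existsP[p Sp]|] := boolP [exists p, occ S p]; last first.
    by rewrite negb_exists => /forallP h; rewrite (occ0 h).
  rewrite (ext_basis_creation Sp) -[_ *: _]addr0; apply: Plin => //.
  apply: Pc; apply: IH.
  rewrite -ltnS; apply: leq_trans hm; apply: proper_card.
  apply/properP; split.
    apply/fintype.subsetP => q; rewrite !inE occ_flip; case: eqP => [-> //|_].
    by rewrite addbF.
  by exists p; rewrite !inE ?occ_flip ?eqxx Sp.
move=> u; rewrite (ext_basisE u).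
by elim/big_ind: _ => // [v w hv hw|S _];
  [rewrite -[v]scale1r; exact: Plin | rewrite -[_ *: _]addr0; exact: Plin].
Qed.
End modes.

(** * The wedge product in terms of creation operators *)

Section wedge_modes.
Context {R : realType} {n : nat}.
Local Open Scope set_scope.
Implicit Types (p q : bool * 'I_n) (S T : {set 'I_n} * {set 'I_n}).
Implicit Types u v w : ext R n.

Definition gen p : ext R n := if p.1 then dxi R p.2 else dx R p.2.

Definition sub_modes T S := (T.1 \subset S.1) && (T.2 \subset S.2).
Definition diff_modes S T := (S.1 :\: T.1, S.2 :\: T.2).
(** The sign of the shuffle that sorts the modes of T followed by those of S.
    *)
Definition shuffle_sign T S : R := \prod_(q | occ T q) mode_sign q S.

Lemma inversionsE (I K : {set 'I_n}) :
  inversions I K = (\sum_(i in I) \sum_(j : 'I_n | (j < i)%N) (j \in K))%N.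
Proof.
rewrite /inversions -sum1_card.
rewrite [RHS](eq_bigr (fun i : 'I_n =>
    \sum_(j : 'I_n | (j < i)%N && (j \in K)) 1)%N) => [|i _]; last first.
  by rewrite [RHS]big_mkcondr; apply: eq_bigr => j _; case: (j \in K).
rewrite pair_big_dep; apply: eq_bigl => -[i j].
by rewrite inE /= [(j \in K) && _]andbC.
Qed.

Lemma mode_sign_false i S :
  mode_sign (false, i) S = (-1) ^+ (\sum_(j : 'I_n | (j < i)%N) (j \in S.1))%N :> R.
Proof.
rewrite /mode_sign -prodrXr.
rewrite -(pair_big_dep xpredT (fun b j => before (b, j) (false, i))
  (fun b j => (-1) ^+ occ S (b, j))) /=.
by rewrite big_bool /= big_pred0 ?mul1r.
Qed.

Lemma mode_sign_true i S : mode_sign (true, i) S =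
  (-1) ^+ (#|S.1| + \sum_(j : 'I_n | (j < i)%N) (j \in S.2))%N :> R.
Proof.
rewrite /mode_sign exprD -prodrXr.
rewrite -(pair_big_dep xpredT (fun b j => before (b, j) (true, i))
  (fun b j => (-1) ^+ occ S (b, j))) /=.
rewrite big_bool /= mulrC; congr (_ * _).
rewrite -sum1_card -prodrXr [RHS]big_mkcond /=; apply: eq_bigr => j _.
by rewrite /occ /=; case: (j \in S.1).
Qed.

Lemma shuffle_signE I K S : shuffle_sign (I, K) S =
  (-1) ^+ (#|K| * #|S.1| + inversions I S.1 + inversions K S.2)%N.
Proof.
rewrite /shuffle_sign.
rewrite -(pair_big_dep xpredT (fun b i => occ (I, K) (b, i))
  (fun b i => mode_sign (b, i) S)) /= big_bool /= /occ /=.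
under eq_bigr do rewrite mode_sign_true.
under [X in _ * X]eq_bigr do rewrite mode_sign_false.
rewrite !prodrXr -exprD !inversionsE big_split /= sum_nat_const.
by congr (_ ^+ _); rewrite addnAC.
Qed.

Lemma wedgeE u v S : wedge u v S =
  \sum_(T | sub_modes T S)
     shuffle_sign T (diff_modes S T) * u T * v (diff_modes S T).
Proof.
rewrite ffunE; rewrite pair_big_dep /=.
apply: eq_big => [[I K]|[I K] _]; first by rewrite !inE.
by rewrite shuffle_signE.
Qed.

Lemma wedge_is_linear u : linear (wedge u).
Proof.
move=> a v w; apply/ffunP => S; rewrite [RHS]ffunE [X in _ = X + _]ffunE !wedgeE.
rewrite scaleRE mulr_sumr -big_split /=; apply: eq_bigr => T _.
by rewrite !ffunE [LHS]mulrDr; congr (_ + _); exact: mulrCA.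
Qed.
HB.instance Definition _ u := GRing.isLinear.Build R (ext R n) (ext R n) _
  (wedge u) (wedge_is_linear u).

Lemma wedge_linearl w : linear (fun u => wedge u w).
Proof.
move=> a u v; apply/ffunP => S; rewrite [RHS]ffunE [X in _ = X + _]ffunE !wedgeE.
rewrite scaleRE mulr_sumr -big_split /=; apply: eq_bigr => T _.
rewrite !ffunE [X in X * _ = _]mulrDr [LHS]mulrDl; congr (_ + _).
by rewrite -!mulrA; exact: mulrCA.
Qed.

Lemma wedge0l w : wedge 0 w = 0.
Proof. by have /= := wedge_linearl w (-1) 0 0; rewrite scaler0 addr0 scaleN1r addNr. Qed.
Lemma wedgeDl u v w : wedge (u + v) w = wedge u w + wedge v w.
Proof. by rewrite -[u]scale1r wedge_linearl !scale1r. Qed.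
Lemma wedgeZl a u w : wedge (a *: u) w = a *: wedge u w.
Proof. by rewrite -[a *: u]addr0 wedge_linearl wedge0l addr0. Qed.
Lemma wedge_suml (I : Type) (r : seq I) (P : pred I) (F : I -> ext R n) w :
  wedge (\sum_(i <- r | P i) F i) w = \sum_(i <- r | P i) wedge (F i) w.
Proof.
by elim/big_rec2: _ => [|i x y _ <-]; rewrite ?wedge0l ?wedgeDl.
Qed.

Lemma sub_modesP T S :
  reflect (forall q, occ T q -> occ S q) (sub_modes T S).
Proof.
apply: (iffP andP) => [[/fintype.subsetP h1 /fintype.subsetP h2] [[] i]|h].
- exact: h2.
- exact: h1.
split; apply/fintype.subsetP => i; first exact: (h (false, i)).
exact: (h (true, i)).
Qed.

Lemma occ_diff S T q : occ (diff_modes S T) q = occ S q && ~~ occ T q.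
Proof. by case: q => [[] i]; rewrite /occ /= inE andbC. Qed.

Lemma wedge_one u : wedge (ext_one R n) u = u.
Proof.
apply/ffunP => S; rewrite wedgeE (bigD1 (finset.set0, finset.set0)) /=; last first.
  by rewrite /sub_modes !finset.sub0set.
rewrite big1 ?addr0 => [|T /andP[_ /negPf h]]; last first.
  by rewrite ffunE h mulr0 mul0r.
rewrite ffunE eqxx mulr1 /shuffle_sign big_pred0 ?mul1r => [|q]; last first.
  by rewrite /occ /= if_same inE.
by rewrite /diff_modes /= !finset.setD0; case: S.
Qed.

(** Associativity when the first factor is a generator, the case from which
    iterated products are computed. Toggling p in the summation index matches
    the two sums; the signs agree because the modes of S before p are those of
    T before p together with those of its complement. *)
Lemma wedge_creation p u v :
  wedge (creation p u) v = creation p (wedge u v).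
Proof.
apply/ffunP => S; rewrite [RHS]ffunE !wedgeE.
rewrite (reindex_inj (inv_inj (flipK p))) /=.
under eq_bigr do rewrite ffunE flipK occ_flip eqxx addbT.
case Sp: (occ S p); last first.
  rewrite !mul0r big1 // => T /sub_modesP/(_ p); rewrite occ_flip eqxx Sp addbT.
  by case: (occ T p) => [|/(_ isT)//]; rewrite /= !(mul0r, mulr0).
rewrite mul1r mulr_sumr big_mkcond [RHS]big_mkcond /=; apply: eq_bigr => T _.
case Tp: (occ T p).
  have -> : sub_modes T (flip p S) = false.
    by apply/negP => /sub_modesP/(_ p Tp); rewrite occ_flip Sp eqxx.
  by case: ifP => // _; rewrite /= !(mul0r, mulr0).
have -> : sub_modes (flip p T) S = sub_modes T (flip p S).
  apply/sub_modesP/sub_modesP => h q.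
    have := h q; rewrite !occ_flip; case: eqP => [->|_]; first by rewrite Tp.
    by rewrite !addbF.
  have := h q; rewrite !occ_flip; case: eqP => [->|_]; first by rewrite Sp.
  by rewrite !addbF.
case: ifP => // /sub_modesP TS.
have eU : diff_modes S (flip p T) = diff_modes (flip p S) T.
  apply: occ_inj => q; rewrite !occ_diff !occ_flip.
  by case: eqP => [->|_]; rewrite ?Sp ?Tp ?addbF.
rewrite eU; set U := diff_modes _ _.
have -> : shuffle_sign (flip p T) U = mode_sign p U * shuffle_sign T U.
  rewrite /shuffle_sign (bigD1 p) /= ?occ_flip ?Tp ?eqxx //.
  congr (_ * _); apply: eq_bigl => q; rewrite occ_flip.
  by case: eqP => [->|_]; rewrite ?Tp ?addbF ?andbT.
have -> : mode_sign p S = mode_sign p U * mode_sign p T :> R.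
  rewrite /mode_sign -big_split /=; apply: eq_bigr => q qp.
  rewrite occ_diff occ_flip.
  have nqp : q != p by apply: contraTneq qp => ->; rewrite before_irr.
  have := TS q; rewrite occ_flip (negPf nqp) !addbF.
  by case: (occ T q) => [->|_] /=; rewrite ?andbT ?expr0 ?mul1r ?mulr1.
rewrite mode_sign_flip before_irr expr0 mul1r mul1r.
by rewrite !mulrA; congr (_ * _ * _); rewrite -!mulrA; congr (_ * _); rewrite mulrC.
Qed.

Lemma genE p : gen p = creation p (ext_one R n).
Proof.
apply/ffunP => S; rewrite !ffunE.
have -> : gen p S = (flip p S == (finset.set0, finset.set0))%:R.
  have -> : (flip p S == (finset.set0, finset.set0)) =
            (S == flip p (finset.set0, finset.set0)).
    by rewrite -(inj_eq (inv_inj (flipK p))) flipK.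
  rewrite /gen; case: p => [[] i] /=; rewrite ffunE; congr ((_ == _)%:R);
    congr pair; apply/setP => j; rewrite !inE /= -pair_eqE /pair_eq //=.
case: eqP => [e|_]; last by rewrite mulr0.
have := congr1 (fun S => occ S p) e; rewrite occ_flip eqxx addbT {2}/occ /=.
rewrite if_same inE => /negPn Sp; rewrite Sp mul1r mulr1 /mode_sign big1 // => q qp.
have := congr1 (fun S => occ S q) e; rewrite occ_flip.
have nqp : q != p by apply: contraTneq qp => ->; rewrite before_irr.
by rewrite (negPf nqp) addbF => ->; rewrite /occ /= if_same inE expr0.
Qed.

Lemma wedge_gen p u : wedge (gen p) u = creation p u.
Proof. by rewrite genE wedge_creation wedge_one. Qed.

Lemma wedge_dx (i : 'I_n) u : wedge (dx R i) u = creation (false, i) u.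
Proof. exact: (wedge_gen (false, i)). Qed.
Lemma wedge_dxi (i : 'I_n) u : wedge (dxi R i) u = creation (true, i) u.
Proof. exact: (wedge_gen (true, i)). Qed.

Lemma J_dx (i : 'I_n) : J (dx R i) = dxi R i.
Proof.
rewrite /J (bigD1 ([set i], finset.set0)) //= big1 ?addr0 => [|S /negPf nS].
  rewrite ffunE eqxx scale1r -/(dxi R i) -/(ext_one R n) wedge_dxi.
  by rewrite -(genE (true, i)).
by rewrite ffunE nS scale0r.
Qed.

Lemma J_is_linear : linear (@J R n).
Proof.
move=> a u v; rewrite /J scaler_sumr -big_split /=; apply: eq_bigr => S _.
by rewrite !ffunE scalerDl scalerA.
Qed.
HB.instance Definition _ := GRing.isLinear.Build R (ext R n) (ext R n) _
  (@J R n) J_is_linear.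

End wedge_modes.

(** * Fock forms of anticommuting operators *)

Section fock.
Context {R : realType} {V : lmodType R} {I : eqType}.
Variables (a c : I -> {linear V -> V}) (vc : {linear V -> R | *%R}) (one : V).
Hypothesis car : forall p q u, c p (a q u) = (p == q)%:R *: u - a q (c p u).
Hypothesis anti : forall p q u, c p (c q u) = - c q (c p u).
Hypothesis vc_a : forall p u, vc (a p u) = 0.
Hypothesis c_one : forall p, c p one = 0.
Hypothesis vc_one : vc one = 1.
Implicit Types (l s : seq I) (u v w : V).

Definition word s : V := foldr a one s.

(** The sum, over the subwords s of l, of vc (c_s u) * vc (c_s v). As a
    recursion on l it needs no indexing by subsets, and its properties follow
    by induction on l. *)
Fixpoint fock_form l u v : R :=
  if l is x :: l' then fock_form l' u v + fock_form l' (c x u) (c x v)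
  else vc u * vc v.

Lemma fock_formP l k u v w :
  fock_form l (k *: u + v) w = k * fock_form l u w + fock_form l v w.
Proof.
elim: l u v w => [|x l IH] u v w /=; first by rewrite linearP /= mulrDl mulrA.
by rewrite linearP !IH; ring.
Qed.

Lemma fock_formC l u v : fock_form l u v = fock_form l v u.
Proof. by elim: l u v => [|x l IH] u v /=; rewrite 1?mulrC // IH [X in _ + X]IH. Qed.

Lemma fock_form_ge0 l u : 0 <= fock_form l u u.
Proof.
by elim: l u => [|x l IH] u /=; [rewrite -expr2 sqr_ge0 | rewrite addr_ge0].
Qed.

Lemma fock_form0 l v : fock_form l 0 v = 0.
Proof.
have := fock_formP l 1 0 0 v; rewrite scaler0 addr0 mul1r.
by move/eqP; rewrite -subr_eq subrr => /eqP <-.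
Qed.

Lemma fock_formN l u v : fock_form l (- u) v = - fock_form l u v.
Proof. by rewrite -[- u]addr0 -scaleN1r fock_formP fock_form0 addr0 mulN1r. Qed.

Lemma anti2 p u : c p (c p u) = 0.
Proof.
have /eqP := anti p p u; rewrite -addr_eq0 -mulr2n -scaler_nat scaler_eq0.
by rewrite pnatr_eq0 /= => /eqP.
Qed.

Lemma fock_form_notin l p u v : p \notin l -> fock_form l (a p u) v = 0.
Proof.
elim: l u v => [|x l IH] u v /=; first by rewrite vc_a mul0r.
rewrite inE negb_or => /andP[px pl].
by rewrite IH // car eq_sym (negPf px) scale0r sub0r fock_formN IH // oppr0 addr0.
Qed.

(** Anticommutation carries a p across the other operators; at the letter p
    itself the extra term disappears since c p is nilpotent. *)
Lemma fock_form_adj l p u v : uniq l -> p \in l ->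
  fock_form l (a p u) v = fock_form l u (c p v).
Proof.
elim: l u v => [|x l IH] u v //= /andP[xl ul]; rewrite inE.
have [-> _|px /= pl] := eqVneq p x.
  rewrite fock_form_notin // car eqxx scale1r anti2 [X in _ = _ + X]fock_formC fock_form0 add0r addr0.
  by rewrite -[u in u - _]scale1r fock_formP fock_formN fock_form_notin // oppr0 addr0 mul1r.
rewrite IH // car eq_sym (negPf px) scale0r sub0r fock_formN IH //.
by rewrite anti [fock_form l _ (- _)]fock_formC fock_formN [fock_form l _ (c x u)]fock_formC opprK.
Qed.

Lemma fock_form_one l v : fock_form l one v = vc v.
Proof.
by elim: l v => [|x l IH] v /=; rewrite ?vc_one ?mul1r // c_one fock_form0 addr0.
Qed.

Lemma fock_form_word l s u : uniq l -> {subset s <= l} ->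
  fock_form l (word s) u = vc (foldl (fun w x => c x w) u s).
Proof.
move=> ul; elim: s u => [|x s IH] u sl /=; first exact: fock_form_one.
rewrite fock_form_adj ?sl ?mem_head // IH // => y ys; apply: sl.
by rewrite inE ys orbT.
Qed.

(** The form is a sum of products of the coefficients vc (c_s u), and these
    are the pairings of u with the words. *)
Lemma fock_form_complete l u : uniq l ->
  (forall P : pred I, fock_form l (word (seq.filter P l)) u = 0) ->
  fock_form l u u = 0.
Proof.
move=> ul h.
have {}h P : vc (foldl (fun w x => c x w) u (seq.filter P l)) = 0.
  by rewrite -(h P) fock_form_word // => x; rewrite mem_filter => /andP[].
elim: l ul u h => [|x l IH] /= ul u h; first by rewrite (h predT) mul0r.
case/andP: ul => xl ul.
have e P b : [seq y <- l | (if y == x then b else P y)] = seq.filter P l.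
  by apply: eq_in_filter => y yl; case: eqP yl xl => // -> ->.
rewrite !IH ?addr0 // => P.
  by have := h (fun y => if y == x then true else P y); rewrite eqxx e.
by have := h (fun y => if y == x then false else P y); rewrite eqxx e.
Qed.

(** If the form vanishes at u, then so does the form along a shorter list, at
    u and at c x u. Going down the list, more and more operators annihilate
    the vector, until the hypothesis on the vacuum applies. *)
Lemma fock_form_pos l u :
  (forall w, (forall p, p \in l -> c p w = 0) -> w = vc w *: one) ->
  u != 0 -> 0 < fock_form l u u.
Proof.
move=> vac; rewrite lt_neqAle fock_form_ge0 andbT; apply: contraNN.
rewrite eq_sym => /eqP h; apply/eqP.
suff {h u} : forall l2 l1 u, l = l1 ++ l2 -> (forall p, p \in l1 -> c p u = 0) ->
    fock_form l2 u u = 0 -> u = 0 by move/(_ l [::] u); apply.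
elim=> [|x l2 IH] l1 u el h1 /=.
  move/eqP; rewrite -expr2 expf_eq0 /= => /eqP h0.
  by rewrite (vac u) ?h0 ?scale0r // => p; rewrite el cats0; exact: h1.
move/eqP; rewrite paddr_eq0 ?fock_form_ge0 // => /andP[/eqP h2 /eqP h3].
have {}el : l = rcons l1 x ++ l2 by rewrite cat_rcons.
have cx : c x u = 0.
  apply: (IH (rcons l1 x)) => // p; rewrite mem_rcons inE => /orP[/eqP->|pl].
    exact: anti2.
  by rewrite anti h1 // linear0 oppr0.
apply: (IH (rcons l1 x)) => // p; rewrite mem_rcons inE => /orP[/eqP->//|].
exact: h1.
Qed.

Variable ip : V -> V -> R.
Hypothesis ipP : forall k u v w, ip (k *: u + v) w = k * ip u w + ip v w.
Hypothesis ipC : forall u v, ip u v = ip v u.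
Hypothesis ip_adj : forall p u v, ip (a p u) v = ip u (c p v).
Hypothesis ip_one : ip one one = 1.

Let ip0 v : ip 0 v = 0.
Proof.
have := ipP 1 0 0 v; rewrite scaler0 addr0 mul1r.
by move/eqP; rewrite -subr_eq subrr => /eqP <-.
Qed.

Lemma c_word p s : p \notin s -> c p (word s) = 0.
Proof.
elim: s => [|x s IH] /=; first by rewrite c_one.
rewrite inE negb_or => /andP[px ps].
by rewrite car (negPf px) scale0r IH // linear0 subrr.
Qed.

(** Compare the first letter: if both words contain it, contracting removes it
    from both; if only one does, the other word is killed by its contraction.
    *)
Lemma words_orthonormal l (P Q : pred I) : uniq l ->
  ip (word (seq.filter P l)) (word (seq.filter Q l)) = (all (fun x => P x == Q x) l)%:R.
Proof.
elim: l => [|x l IH] //= /andP[xl ul].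
have xf (T : pred I) : x \notin seq.filter T l by rewrite mem_filter (negPf xl) andbF.
case: (P x) (Q x) => [] [] //=; rewrite ?IH //.
- rewrite ip_adj car eqxx scale1r c_word // linear0 subr0; exact: IH.
- by rewrite ip_adj c_word // ipC ip0.
- by rewrite ipC ip_adj c_word // ipC ip0.
Qed.
End fock.

(** * Adapted frames *)

Definition posdef (R : realType) n (W : 'M[R]_n) :=
  W^T = W /\ forall v : 'rV[R]_n, v != 0 -> 0 < (v *m W *m v^T) 0 0.

(** Split off the first row and column. The Schur complement is positive
    definite because its quadratic form is that of W after minimising over the
    first coordinate. *)
Lemma cholesky (R : realType) n (W : 'M[R]_n) : posdef W ->
  exists E : 'M[R]_n, W = E^T *m E.
Proof.
elim: n W => [|n IH] W [Wsym Wpos]; first by exists 1%:M; apply/matrixP => -[].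
pose W1 : 'M[R]_(1 + n) := W.
pose r := ursubmx W1; pose N := drsubmx W1; pose d : R := W1 0 0.
have Wr : dlsubmx W1 = r^T by rewrite /r -[W1 in RHS]Wsym -trmx_dlsub trmxK.
have Nsym : N^T = N by rewrite /N trmx_drsub [W1^T]Wsym.
have WE : W1 = block_mx d%:M r r^T N.
  rewrite -[LHS]submxK Wr; congr block_mx.
  by rewrite [LHS]mx11_scalar !mxE !lshift0.
have ry (y : 'rV[R]_n) : (y *m r^T) 0 0 = (r *m y^T) 0 0.
  by rewrite -[in LHS](trmxK y) -trmx_mul [LHS]mxE.
have quad (x : R) (y : 'rV[R]_n) :
    (row_mx x%:M y *m W1 *m (row_mx x%:M y)^T) 0 0 =
    x ^+ 2 * d + x * (r *m y^T) 0 0 *+ 2 + (y *m N *m y^T) 0 0.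
  rewrite WE mul_row_block tr_row_mx mul_row_col tr_scalar_mx !mulmxDl.
  rewrite !mul_scalar_mx !mul_mx_scalar -scalemxAl mulr2n.
  rewrite [LHS]mxE [X in X + _]mxE [X in _ + X]mxE.
  have zE (k : R) (X : 'M[R]_1) : (k *: X) 0 0 = k * X 0 0 by rewrite mxE.
  have -> : d%:M = d *: 1%:M :> 'M[R]_1 by rewrite scalemx1.
  by rewrite !zE ry [1%:M 0 0]mxE eqxx mulr1; ring.
have dpos : 0 < d.
  have := Wpos (row_mx 1%:M 0 : 'rV[R]_(1 + n)); rewrite (quad 1 0).
  rewrite trmx0 mulmx0 mul0mx mul0mx !mxE !mulr0 mul0rn !addr0 expr1n mul1r.
  apply; apply/eqP => /rowP/(_ 0); rewrite !mxE.
  by case: splitP => // j _; rewrite !mxE ord1 eqxx => /eqP; rewrite oner_eq0.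
pose N1 := N - d^-1 *: (r^T *m r).
have [E1 EE1] : exists E1 : 'M[R]_n, N1 = E1^T *m E1.
  apply: IH; split=> [|y y0].
    by rewrite /N1 linearB linearZ /= trmx_mul trmxK Nsym.
  (* this first coordinate minimises the quadratic form of W over y *)
  pose x := - d^-1 * (r *m y^T) 0 0.
  have := Wpos (row_mx x%:M y : 'rV[R]_(1 + n)); rewrite (quad x y).
  have -> : (y *m N1 *m y^T) 0 0 =
     (y *m N *m y^T) 0 0 - d^-1 * ((r *m y^T) 0 0) ^+ 2.
    rewrite /N1 mulmxBr mulmxBl mxE [X in _ + X]mxE; congr (_ - _).
    rewrite -scalemxAr -scalemxAl mxE; congr (_ * _).
    by rewrite mulmxA -(mulmxA (y *m r^T)) mxE big_ord1 ry expr2.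
  have -> : x ^+ 2 * d + x * (r *m y^T) 0 0 *+ 2 = - (d^-1 * ((r *m y^T) 0 0) ^+ 2).
    by rewrite /x; field; rewrite gt_eqF.
  rewrite addrC; apply; apply: contraNneq y0 => h.
  by apply/eqP; rewrite -[y](@row_mxKr _ _ _ _ (x%:M)) h linear0.
pose sd := Num.sqrt d.
have sd2 : sd * sd = d by rewrite -expr2 sqr_sqrtr // ltW.
have sd0 : sd != 0 by rewrite gt_eqF // sqrtr_gt0.
pose E2 : 'M[R]_(1 + n) := block_mx sd%:M (sd^-1 *: r) 0 E1.
suff : W1 = E2^T *m E2 by move=> h; exists E2.
rewrite WE tr_block_mx mulmx_block !trmx0 !tr_scalar_mx.
rewrite !mul0mx !mulmx0 !addr0 -scalar_mxM sd2.
rewrite mul_scalar_mx scalerA divff // scale1r linearZ /=.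
rewrite -scalemxAl mul_mx_scalar scalerA mulVf // scale1r.
rewrite -scalemxAl -scalemxAr scalerA -invfM sd2.
by rewrite -EE1 /N1 addrC subrK.
Qed.

Lemma posdef_unitmx (R : realType) n (W : 'M[R]_n) : posdef W -> W \in unitmx.
Proof.
case=> _ Wpos; rewrite -row_free_unit -kermx_eq0; apply/negPn/negP => k0.
have [i ri] : exists i, row i (kermx W) != 0.
  apply/existsP; apply: contraNT k0; rewrite negb_exists => /forallP h.
  by apply/eqP/row_matrixP => i; rewrite row0; apply/eqP/negPn.
have := Wpos _ ri; rewrite -row_mul mulmx_ker row0 mul0mx mxE.
by rewrite ltxx.
Qed.

Section combined_modes.
Context {R : realType} {n : nat}.
Local Open Scope set_scope.
Implicit Types (p q : bool * 'I_n) (A B E W : 'M[R]_n) (u v : ext R n).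

Definition creation_mx E p u : ext R n :=
  \sum_j E p.2 j *: creation (p.1, j) u.
(** At the inverse of the matrix of omega this is the metric adjoint of
    creation. *)
Definition contraction_mx E p u : ext R n :=
  \sum_j E p.2 j *: contraction (p.1, j) u.

Lemma creation_mx_is_linear E p : linear (creation_mx E p).
Proof.
move=> k u v; rewrite /creation_mx scaler_sumr -big_split /=.
by apply: eq_bigr => j _; rewrite linearP scalerDr !scalerA mulrC.
Qed.
HB.instance Definition _ E p := GRing.isLinear.Build R (ext R n) (ext R n) _
  (creation_mx E p) (creation_mx_is_linear E p).

Lemma contraction_mx_is_linear E p : linear (contraction_mx E p).
Proof.
move=> k u v; rewrite /contraction_mx scaler_sumr -big_split /=.
by apply: eq_bigr => j _; rewrite linearP scalerDr !scalerA mulrC.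
Qed.
HB.instance Definition _ E p := GRing.isLinear.Build R (ext R n) (ext R n) _
  (contraction_mx E p) (contraction_mx_is_linear E p).

Lemma contraction_mxD E p u v : contraction_mx E p (u + v) = contraction_mx E p u + contraction_mx E p v.
Proof. exact: linearD. Qed.
Lemma contraction_mxZ E p k u : contraction_mx E p (k *: u) = k *: contraction_mx E p u.
Proof. exact: linearZ. Qed.
Lemma contraction_mx_sum E p (I : Type) (r : seq I) (P : pred I) (F : I -> ext R n) :
  contraction_mx E p (\sum_(i <- r | P i) F i) = \sum_(i <- r | P i) contraction_mx E p (F i).
Proof. exact: linear_sum. Qed.

Lemma creation_mxM A B p u :
  creation_mx (A *m B) p u = \sum_j A p.2 j *: creation_mx B (p.1, j) u.
Proof.
rewrite /creation_mx; under eq_bigr do rewrite mxE scaler_suml.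
rewrite exchange_big; apply: eq_bigr => j _.
by rewrite scaler_sumr; apply: eq_bigr => k _; rewrite scalerA.
Qed.

Lemma contraction_mxM A B p u :
  contraction_mx (A *m B) p u = \sum_j A p.2 j *: contraction_mx B (p.1, j) u.
Proof.
rewrite /contraction_mx; under eq_bigr do rewrite mxE scaler_suml.
rewrite exchange_big; apply: eq_bigr => j _.
by rewrite scaler_sumr; apply: eq_bigr => k _; rewrite scalerA.
Qed.

Lemma sum_delta (F : 'I_n -> ext R n) i :
  \sum_j (1%:M : 'M[R]_n) i j *: F j = F i.
Proof.
rewrite (bigD1 i) //= big1 ?addr0 => [|j ji]; first by rewrite mxE eqxx scale1r.
by rewrite mxE eq_sym (negPf ji) scale0r.
Qed.

Lemma creation_mx1 p u : creation_mx 1%:M p u = creation p u.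
Proof. by case: p => b i; rewrite /creation_mx (sum_delta (fun j => _)). Qed.

Lemma contraction_mx1 p u : contraction_mx 1%:M p u = contraction p u.
Proof. by case: p => b i; rewrite /contraction_mx (sum_delta (fun j => _)). Qed.

Lemma contraction_mx_creation_mx A B p q u :
  contraction_mx A p (creation_mx B q u) =
  ((p.1 == q.1)%:R * (A *m B^T) p.2 q.2) *: u
    - creation_mx B q (contraction_mx A p u).
Proof.
rewrite /contraction_mx /creation_mx.
under eq_bigr do rewrite contraction_sum scaler_sumr.
under [X in _ - X]eq_bigr do rewrite creation_sum scaler_sumr.
rewrite [X in _ - X]exchange_big mxE mulr_sumr scaler_suml -sumrB.
apply: eq_bigr => j _.
under [LHS]eq_bigr do rewrite contractionZ contraction_creation.
under [X in _ - X]eq_bigr do rewrite creationZ.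
have -> : ((p.1 == q.1)%:R * (A p.2 j * B^T j q.2)) *: u =
   \sum_k (A p.2 j * B q.2 k * ((p.1, j) == (q.1, k))%:R) *: u.
  rewrite (bigD1 j) //= big1 ?addr0 => [|k kj].
    by rewrite mxE -pair_eqE /pair_eq /= eqxx andbT mulrC.
  by rewrite -pair_eqE /pair_eq /= [j == k]eq_sym (negPf kj) andbF mulr0 scale0r.
rewrite -sumrB; apply: eq_bigr => k _.
by rewrite scalerBr scalerBr !scalerA [B _ _ * A _ _]mulrC.
Qed.

Lemma contraction_mxC A B p q u :
  contraction_mx A p (contraction_mx B q u) =
  - contraction_mx B q (contraction_mx A p u).
Proof.
rewrite /contraction_mx.
under eq_bigr do rewrite contraction_sum scaler_sumr.
under [X in _ = - X]eq_bigr do rewrite contraction_sum scaler_sumr.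
rewrite exchange_big -sumrN; apply: eq_bigr => j _.
rewrite -sumrN; apply: eq_bigr => k _.
rewrite !contractionZ contractionC scalerN scalerN !scalerA.
by rewrite [A _ _ * _]mulrC.
Qed.

Lemma vac_creation_mx E p u : vac (creation_mx E p u) = 0.
Proof.
rewrite /creation_mx linear_sum big1 // => j _.
by rewrite linearZ /= vac_creation mulr0.
Qed.

Lemma contraction_mx_one E p : contraction_mx E p (ext_one R n) = 0.
Proof. by rewrite /contraction_mx big1 // => j _; rewrite contraction_one scaler0. Qed.

(** The order of this list is that of the factors of frame. *)
Definition modes : seq (bool * 'I_n) :=
  [seq (false, i) | i <- enum 'I_n] ++ [seq (true, i) | i <- enum 'I_n].

Lemma mem_modes p : p \in modes.
Proof.
by case: p => [[] i]; rewrite mem_cat; apply/orP; [right|left];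
  rewrite map_f // mem_enum.
Qed.

Lemma modes_uniq : uniq modes.
Proof.
rewrite cat_uniq; apply/and3P; split.
- by rewrite map_inj_uniq ?enum_uniq // => i j [].
- by apply/hasPn => _ /mapP[i _ ->]; apply/negP => /mapP[j _].
- by rewrite map_inj_uniq ?enum_uniq // => i j [].
Qed.

(** Frame forms are words in creation operators, to which the results on Fock
    forms apply. *)
Lemma frameE (e : 'I_n -> 'rV[R]_n) S :
  frame e S = word (creation_mx (\matrix_(i, j) e i 0 j)) (ext_one R n)
                (seq.filter (occ S) modes).
Proof.
set E := \matrix_(i, j) _.
have form1E i u : wedge (form1 (e i)) u = creation_mx E (false, i) u.
  rewrite /form1 wedge_suml; apply: eq_bigr => j _.
  by rewrite wedgeZl wedge_dx mxE.
have JE i u : wedge (J (form1 (e i))) u = creation_mx E (true, i) u.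
  rewrite /form1 linear_sum wedge_suml; apply: eq_bigr => j _.
  by rewrite linearZ /= wedgeZl J_dx wedge_dxi mxE.
have assoc p u v :
    wedge (creation_mx E p u) v = creation_mx E p (wedge u v).
  rewrite /creation_mx wedge_suml; apply: eq_bigr => j _.
  by rewrite wedgeZl wedge_creation.
have setE (f : 'I_n -> ext R n) b I v :
    (forall i u, wedge (f i) u = creation_mx E (b, i) u) ->
    wedge (wedge_set f I) v =
    foldr (creation_mx E) v [seq (b, i) | i <- enum 'I_n & i \in I].
  move=> fE; rewrite /wedge_set.
  have -> : [seq i <- enum 'I_n | i \in I] = enum I by rewrite !enumT.
  elim: (enum I) => [|i s IH] /=; first by rewrite big_nil wedge_one.
  by rewrite big_cons fE assoc IH.
have wset1 (f : 'I_n -> ext R n) I b :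
    (forall i u, wedge (f i) u = creation_mx E (b, i) u) ->
    wedge_set f I =
    foldr (creation_mx E) (ext_one R n) [seq (b, i) | i <- enum 'I_n & i \in I].
  move=> fE; rewrite /wedge_set.
  have -> : [seq i <- enum 'I_n | i \in I] = enum I by rewrite !enumT.
  elim: (enum I) => [|i s IH] /=; first by rewrite big_nil.
  by rewrite big_cons fE IH.
rewrite /frame (setE _ false) // (wset1 _ _ true) // /word /modes.
by rewrite filter_cat foldr_cat !filter_map.
Qed.

Lemma orthonormal_frameP W (e : 'I_n -> 'rV[R]_n) :
  let E := \matrix_(i, j) e i 0 j in
  orthonormal_frame W e <-> E *m invmx W *m E^T = 1%:M.
Proof.
move=> E.
have h i j : (E *m invmx W *m E^T) i j = ip1 W (e i) (e j).
  rewrite mxE /ip1 exchange_big /=; apply: eq_bigr => k _.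
  rewrite !mxE mulr_suml; apply: eq_bigr => l _.
  by rewrite !mxE [_ l k * _]mulrC.
split=> [he|he i j]; last by rewrite -h he mxE.
by apply/matrixP => i j; rewrite h he mxE.
Qed.

(** If W = E^T E, then the rows of E are orthonormal for the inverse of W. *)
Lemma adapted_frame W : posdef W -> exists E : 'M[R]_n, E *m invmx W *m E^T = 1%:M.
Proof.
move=> Wpd; have [E WE] := cholesky Wpd.
have uE : E \in unitmx.
  have := posdef_unitmx Wpd; rewrite WE !unitmxE det_mulmx det_tr.
  by rewrite unitrM => /andP[].
exists E; have -> : invmx W = invmx E *m invmx E^T.
  apply: (can_inj (mulKmx (posdef_unitmx Wpd))).
  rewrite mulmxV ?posdef_unitmx // [in RHS]WE mulmxA -(mulmxA E^T).
  by rewrite mulmxV // mulmx1 mulmxV // unitmx_tr.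
by rewrite !mulmxA mulmxV // mul1mx mulVmx // unitmx_tr.
Qed.
End combined_modes.

(** * The induced inner product *)

Section super_ip_spec.
Context {R : realType} {n : nat}.
Local Open Scope set_scope.
Implicit Types (p q : bool * 'I_n) (A B E W : 'M[R]_n) (u v w : ext R n).

(** Being adjoint is bilinear in the two matrices, hence invariant under a
    change of basis. *)
Lemma ip_adjoint_change (ip : ext R n -> ext R n -> R) E A :
  inner_product ip ->
  (forall p u v, ip (creation_mx E p u) v = ip u (contraction_mx A p v)) ->
  forall B p u v,
  ip (creation_mx (B *m E) p u) v = ip u (contraction_mx (B *m A) p v).
Proof.
move=> [ipP ipC _] adj B p u v.
have ip0 w : ip 0 w = 0.
  by have := ipP (-1) 0 0 w; rewrite scaler0 addr0 mulN1r addNr.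
have ipsum (F G : 'I_n -> ext R n) (k : 'I_n -> R) w w' :
    (forall j, ip (F j) w = ip w' (G j)) ->
    ip (\sum_j k j *: F j) w = ip w' (\sum_j k j *: G j).
  move=> FG; rewrite [RHS]ipC.
  elim/big_rec2: _ => [|j y z _ IH]; first by rewrite !ip0.
  by rewrite !ipP IH FG ipC.
rewrite creation_mxM contraction_mxM.
by apply: (ipsum (fun j => creation_mx E (p.1, j) u)
                 (fun j => contraction_mx A (p.1, j) v)) => j.
Qed.

(** An orthonormal frame turns the adjunction rule into canonical
    anticommutation relations, and these imply orthonormality of words. In
    particular the condition that defines induced inner products does not
    depend on the frame. *)
Lemma frame_orthonormal (ip : ext R n -> ext R n -> R) W :
  inner_product ip ->
  (forall p u v, ip (creation p u) v = ip u (contraction_mx (invmx W) p v)) ->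
  ip (ext_one R n) (ext_one R n) = 1 ->
  induced_inner_product W ip.
Proof.
move=> hip adj ip1; split=> // e /orthonormal_frameP.
set E := \matrix_(i, j) _ => hE S T; case: (hip) => ipP ipC _.
have adj1 p u v :
    ip (creation_mx E p u) v = ip u (contraction_mx (E *m invmx W) p v).
  rewrite -[E in LHS]mulmx1; apply: ip_adjoint_change => // r x y.
  by rewrite creation_mx1.
have car p q u : contraction_mx (E *m invmx W) p (creation_mx E q u) =
    (p == q)%:R *: u - creation_mx E q (contraction_mx (E *m invmx W) p u).
  by rewrite contraction_mx_creation_mx hE mxE -natrM mulnb -pair_eqE.
have c1 p := contraction_mx_one (E *m invmx W) p.
rewrite !frameE (words_orthonormal car c1 ipP) // ?modes_uniq //.
congr (nat_of_bool _)%:R; apply/allP/eqP => [h|-> p _ //].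
by apply: occ_inj => p; apply/eqP/h/mem_modes.
Qed.

Definition frame_ip W E : ext R n -> ext R n -> R :=
  fock_form (contraction_mx (E *m invmx W)) vac modes.

(** The last clause says that the frame forms are complete; it yields the
    uniqueness of the induced inner product. *)
Lemma frame_ip_spec W E : posdef W -> E *m invmx W *m E^T = 1%:M ->
  [/\ inner_product (frame_ip W E),
      forall p u v, frame_ip W E (creation p u) v =
                    frame_ip W E u (contraction_mx (invmx W) p v),
      frame_ip W E (ext_one R n) (ext_one R n) = 1 &
      forall u, (forall S, frame_ip W E
           (word (creation_mx E) (ext_one R n) (seq.filter (occ S) modes)) u = 0) ->
        u = 0].
Proof.
move=> Wpd hE; set C := contraction_mx (E *m invmx W).
have car p q u : C p (creation_mx E q u) = (p == q)%:R *: u - creation_mx E q (C p u).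
  by rewrite /C contraction_mx_creation_mx hE mxE -natrM mulnb -pair_eqE.

have anti p q u : C p (C q u) = - C q (C p u) by exact: contraction_mxC.
have vacC p u : vac (creation_mx E p u) = 0 by exact: vac_creation_mx.
have C1 p : C p (ext_one R n) = 0 by exact: contraction_mx_one.
have uE : E \in unitmx.
  have : \det (E *m invmx W *m E^T) = 1 by rewrite hE det1.
  rewrite !det_mulmx det_tr unitmxE unitfE => h.
  by apply: contra_eq_neq h => ->; rewrite !mul0r eq_sym oner_neq0.
have ipos u : u != 0 -> 0 < frame_ip W E u u.
  apply: (fock_form_pos (one := ext_one R n) anti) => w hw.
  apply: vacuum_unique => p.
  rewrite -contraction_mx1 -(mulVmx (_ : E *m invmx W \in unitmx)).
    rewrite contraction_mxM big1 // => j _.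
    by have := hw (p.1, j) (mem_modes _); rewrite /C => ->; rewrite scaler0.
  by rewrite unitmx_mul uE unitmx_inv posdef_unitmx.
have ipP : inner_product (frame_ip W E).
  split=> //.
  - exact: (fock_formP C).
  - exact: (fock_formC C).
split=> //.
- move=> p u v; rewrite -[creation p u]creation_mx1 -(mulVmx uE).
  rewrite (ip_adjoint_change (A := E *m invmx W)) // ?mulKmx //.
  by move=> q x y; apply: fock_form_adj; rewrite ?modes_uniq ?mem_modes.
- exact: etrans (fock_form_one C1 vac_one _ _) vac_one.
move=> u hu; apply: contraTeq isT => u0; have := ipos _ u0.
rewrite /frame_ip (fock_form_complete car anti vacC C1 vac_one) ?ltxx ?modes_uniq //.
move=> P.
(* every subword of modes is the word of a frame form *)
pose S := ([set i | P (false, i)], [set i | P (true, i)]).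
rewrite -(hu S) /frame_ip; congr (fock_form _ _ _ (word _ _ _) _).
by apply: eq_filter => -[[] i]; rewrite /occ /= inE.
Qed.

(** Existence is given by the Fock form of one adapted frame. Uniqueness holds
    because any two induced inner products have the same orthonormal basis.
    From here on, super_ip is known through these three properties only. *)
Lemma super_ip_spec W : posdef W ->
  [/\ inner_product (super_ip W),
      forall p u v, super_ip W (creation p u) v =
                    super_ip W u (contraction_mx (invmx W) p v) &
      super_ip W (ext_one R n) (ext_one R n) = 1].
Proof.
move=> Wpd; have [E hE] := adapted_frame Wpd.
have [ipP adj ip1 compl] := frame_ip_spec Wpd hE.
suff -> : super_ip W = frame_ip W E by [].
set ip0 := frame_ip W E in ipP adj ip1 compl *.
have hip0 : induced_inner_product W ip0 by exact: frame_orthonormal.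
pose e i := row i E.
have eE : \matrix_(i, j) e i 0 j = E by apply/matrixP => i j; rewrite !mxE.
have he : orthonormal_frame W e by apply/orthonormal_frameP; rewrite eE.
have hip : induced_inner_product W (super_ip W).
  by rewrite /super_ip; apply: (xgetPex _ (ex_intro _ ip0 hip0)).
have sumip (ip : ext R n -> ext R n -> R) : inner_product ip ->
    forall (F : {set 'I_n} * {set 'I_n} -> ext R n) (k : _ -> R) v,
    ip (\sum_S k S *: F S) v = \sum_S k S * ip (F S) v.
  move=> [h _ _] F k v; elim/big_rec2: _ => [|S y z _ <-]; last by rewrite h.
  by have := h (-1) 0 0 v; rewrite scaler0 addr0 mulN1r addNr.
have expand u : u = \sum_S ip0 (frame e S) u *: frame e S.
  apply/eqP; rewrite -subr_eq0; apply/eqP/compl => S.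
  rewrite -[E in word (creation_mx E)]eE -frameE.
  case: (ipP) => ipl ipC _; rewrite ipC addrC -scaleN1r ipl sumip // mulN1r.
  rewrite (bigD1 S) //= big1 ?addr0 => [|T TS].
    by rewrite hip0.2 // eqxx mulr1 ipC addrC subrr.
  by rewrite hip0.2 // (negPf TS) mulr0.
apply/funext => u; apply/funext => v.
have ipE (ip : ext R n -> ext R n -> R) : induced_inner_product W ip ->
    ip u v = \sum_S ip0 (frame e S) u * ip0 (frame e S) v.
  move=> h; rewrite {1}[u]expand (sumip _ h.1); apply: eq_bigr => S _.
  congr (_ * _); case: (h.1) => _ ipC _; rewrite ipC {1}[v]expand (sumip _ h.1).
  rewrite (bigD1 S) //= big1 ?addr0 => [|T TS]; first by rewrite h.2 // eqxx mulr1.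
  by rewrite h.2 // (negPf TS) mulr0.
by rewrite (ipE _ hip) (ipE _ hip0).
Qed.

End super_ip_spec.

(** * Lefschetz algebra at a point *)

Section kaehler_algebra.
Context {R : realType} {n : nat}.
Local Open Scope set_scope.
Implicit Types (p q : bool * 'I_n) (A B M W X Y : 'M[R]_n) (u v w : ext R n).
Implicit Types (b : bool).

Lemma sum_modes (F : bool * 'I_n -> ext R n) b :
  \sum_p F p = \sum_j F (b, j) + \sum_j F (~~ b, j).
Proof.
transitivity (\sum_c \sum_j F (c, j)).
  by rewrite pair_big; apply: eq_bigr => -[].
by rewrite big_bool; case: b => //; rewrite addrC.
Qed.

(** Contraction with a bivector of matrix Y; at the inverse of the matrix of
    omega and for b = false this is Lambda. The flag exchanges dx and dxi, so
    that one computation proves both Kaehler identities. *)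
Definition contraction2 b Y u : ext R n :=
  \sum_j \sum_k Y j k *: contraction (~~ b, k) (contraction (b, j) u).

(** The derivation of the exterior algebra that extends the linear map of
    matrix X on generators. Variations of the metric act through it. *)
Definition number_op X u : ext R n :=
  \sum_p creation p (contraction_mx X p u).

(** The operator L for the form of matrix W. *)
Definition lefschetz W u : ext R n :=
  \sum_i \sum_j W i j *: creation (false, i) (creation (true, j) u).

Lemma contraction2_is_linear b Y : linear (contraction2 b Y).
Proof.
move=> k u v; rewrite /contraction2 scaler_sumr -big_split; apply: eq_bigr => i _.
rewrite scaler_sumr -big_split; apply: eq_bigr => j _ /=.
by rewrite !(contractionD, contractionZ) scalerDr !scalerA mulrC.
Qed.
HB.instance Definition _ b Y := GRing.isLinear.Build R (ext R n) (ext R n) _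
  (contraction2 b Y) (contraction2_is_linear b Y).

Lemma contraction2_sum b Y (I : Type) (r : seq I) (P : pred I) (F : I -> ext R n) :
  contraction2 b Y (\sum_(i <- r | P i) F i) =
  \sum_(i <- r | P i) contraction2 b Y (F i).
Proof. exact: linear_sum. Qed.

Lemma number_op_is_linear X : linear (number_op X).
Proof.
move=> k u v; rewrite /number_op scaler_sumr -big_split; apply: eq_bigr => p _ /=.
by rewrite !(contraction_mxD, contraction_mxZ, creationD, creationZ).
Qed.
HB.instance Definition _ X := GRing.isLinear.Build R (ext R n) (ext R n) _
  (number_op X) (number_op_is_linear X).

Lemma lefschetz_is_linear W : linear (lefschetz W).
Proof.
move=> k u v; rewrite /lefschetz scaler_sumr -big_split; apply: eq_bigr => i _.
rewrite scaler_sumr -big_split; apply: eq_bigr => j _ /=.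
by rewrite !(creationD, creationZ) scalerDr !scalerA mulrC.
Qed.
HB.instance Definition _ W := GRing.isLinear.Build R (ext R n) (ext R n) _
  (lefschetz W) (lefschetz_is_linear W).

Lemma contraction_mx_creation A p q u :
  contraction_mx A p (creation q u) =
  ((p.1 == q.1)%:R * A p.2 q.2) *: u - creation q (contraction_mx A p u).
Proof.
by rewrite -[X in contraction_mx _ _ X]creation_mx1 contraction_mx_creation_mx
  trmx1 mulmx1 creation_mx1.
Qed.

Lemma contraction_mx_number_op A X p v :
  contraction_mx A p (number_op X v) =
  number_op X (contraction_mx A p v) + contraction_mx (A *m X) p v.
Proof.
rewrite /number_op contraction_mx_sum.
under [LHS]eq_bigr do rewrite contraction_mx_creation.
rewrite big_split /= addrC; congr (_ + _).
  by apply: eq_bigr => q _; rewrite contraction_mxC creationN opprK.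
rewrite (sum_modes _ p.1) /= contraction_mxM.
rewrite [X in _ + X]big1 ?addr0 => [|j _].
  by apply: eq_bigr => j _; rewrite eqxx mul1r.
by case: p.1; rewrite mul0r scale0r.
Qed.

Lemma vac_number_op X u : vac (number_op X u) = 0.
Proof.
rewrite /number_op; elim/big_ind: _ => [|x y hx hy|p _].
- by rewrite /vac ffunE.
- by rewrite /vac ffunE -/(vac x) -/(vac y) hx hy addr0.
- exact: vac_creation.
Qed.

(** The derivative of the inverse of W has the shape of M *m Y *m M, and this
    lemma writes its contraction through metric adjoints. *)
Lemma contraction2_conj b M Y u : M^T = M ->
  contraction2 b (M *m Y *m M) u =
  \sum_i \sum_k Y i k *: contraction_mx M (~~ b, k) (contraction_mx M (b, i) u).
Proof.
move=> Msym; have Ms i j : M i j = M j i by rewrite -[in LHS]Msym mxE.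
have -> : contraction2 b (M *m Y *m M) u =
    \sum_j \sum_k \sum_s \sum_r (M j r * Y r s * M s k) *:
       contraction (~~ b, k) (contraction (b, j) u).
  apply: eq_bigr => j _; apply: eq_bigr => k _.
  rewrite mxE scaler_suml; apply: eq_bigr => s _.
  by rewrite mxE mulr_suml scaler_suml; apply: eq_bigr => r _.
have -> : \sum_i \sum_k Y i k *:
      contraction_mx M (~~ b, k) (contraction_mx M (b, i) u) =
    \sum_r \sum_s \sum_k \sum_j (M j r * Y r s * M s k) *:
       contraction (~~ b, k) (contraction (b, j) u).
  apply: eq_bigr => r _; apply: eq_bigr => s _.
  rewrite /contraction_mx scaler_sumr; apply: eq_bigr => k _ /=.
  rewrite contraction_sum !scaler_sumr; apply: eq_bigr => j _.
  rewrite contractionZ !scalerA; congr (_ *: _).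
  by rewrite (Ms r j); ring.
under eq_bigr do rewrite exchange_big /=.
rewrite exchange_big /=.
under eq_bigr do under eq_bigr do rewrite exchange_big /=.
under eq_bigr do rewrite exchange_big /=.
rewrite exchange_big /=.
apply: eq_bigr => r _; apply: eq_bigr => s _.
by rewrite exchange_big.
Qed.

(** The commutator of Lambda with a generator of one kind is the metric
    contraction of the other kind. This is how codifferentials arise from
    commutators with Lambda. *)
Lemma contraction2_creation b M i u : M^T = M ->
  contraction2 b M (creation (~~ b, i) u) =
  creation (~~ b, i) (contraction2 b M u) - contraction_mx M (b, i) u.
Proof.
move=> Msym; have Ms j k : M j k = M k j by rewrite -[in LHS]Msym mxE.
rewrite /contraction2 creation_sum /contraction_mx -sumrB /=.
apply: eq_bigr => j _; rewrite creation_sum.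
rewrite -[X in _ = _ - X](sum_delta (fun k => M i j *: contraction (b, j) u) i).
rewrite -sumrB; apply: eq_bigr => k _.
rewrite contraction_creation -pair_eqE /pair_eq /=.
have -> : (b == ~~ b) = false by case: b.
rewrite scale0r sub0r contractionN contraction_creation opprB -pair_eqE /pair_eq /=.
rewrite eqxx /= scalerBr creationZ; congr (_ - _).
rewrite [k == i]eq_sym mxE; case: eqP => [->|_]; last by rewrite !scale0r scaler0.
by rewrite !scale1r Ms.
Qed.

Lemma contraction2_tr b M u : M^T = M ->
  contraction2 (~~ b) M u = - contraction2 b M u.
Proof.
move=> Msym; have Ms j k : M j k = M k j by rewrite -[in LHS]Msym mxE.
rewrite /contraction2 negbK exchange_big -sumrN; apply: eq_bigr => j _.
rewrite -sumrN; apply: eq_bigr => k _.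
by rewrite contractionC scalerN Ms.
Qed.

(** Here T i plays the role of the i-th partial derivative of W. The part of
    number_op acting on modes of kind b pairs a symmetric tensor with two
    anticommuting contractions and vanishes; the part acting on the other kind
    is the right-hand side. The two remaining sums cancel by the symmetry of
    T. *)
Lemma kaehler_zero_order b W (T : 'I_n -> 'M[R]_n) u :
  W^T = W -> (forall i j k, T i j k = T j i k) -> (forall i, (T i)^T = T i) ->
  let M := invmx W in
  \sum_i (number_op (- (T i *m M)) (contraction_mx M (b, i) u)
         + contraction_mx (- (M *m T i *m M)) (b, i) u
         + \tr (M *m T i) *: contraction_mx M (b, i) u)
  = \sum_i creation (~~ b, i) (contraction2 b (- (M *m T i *m M)) u).
Proof.
move=> Wsym Tsym Ttr M.
have Msym : M^T = M by rewrite /M trmx_inv Wsym.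
have Ts i j k : T i j k = T i k j by rewrite -[in LHS]Ttr mxE.
have scN A p v : contraction_mx (- A) p v = - contraction_mx A p v.
  by rewrite /contraction_mx -sumrN; apply: eq_bigr => j _; rewrite mxE scaleNr.
rewrite big_split big_split /= -addrA.
have -> : \sum_i contraction_mx (- (M *m T i *m M)) (b, i) u
        + \sum_i \tr (M *m T i) *: contraction_mx M (b, i) u = 0.
  apply/eqP; rewrite addr_eq0 -sumrN; apply/eqP.
  under eq_bigr do rewrite scN contraction_mxM -sumrN.
  rewrite exchange_big /=; apply: eq_bigr => q _; rewrite sumrN -scaler_suml.
  congr (- (_ *: _)); apply: eq_bigr => i _; rewrite !mxE.
  by apply: eq_bigr => j _; rewrite Ts Tsym Ts.
rewrite addr0 /number_op exchange_big /=.
rewrite (sum_modes _ b) /= big1 ?add0r => [|m _].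
  apply: eq_bigr => m _; rewrite -creation_sum; congr (creation _ _).
  have -> : - (M *m T m *m M) = M *m (- T m) *m M by rewrite mulmxN mulNmx.
  rewrite contraction2_conj //; apply: eq_bigr => i _.
  rewrite -mulNmx contraction_mxM; apply: eq_bigr => k _ /=.
  by rewrite !mxE Tsym.
rewrite -creation_sum.
have -> : \sum_i contraction_mx (- (T i *m M)) (b, m) (contraction_mx M (b, i) u)
          = 0; last by rewrite creation0.
(* exchanging the two contractions changes the sign of s *)
set s := \sum_i _.
suff : s = - s by move/eqP; rewrite -addr_eq0 -mulr2n -scaler_nat scaler_eq0 pnatr_eq0 => /eqP.
have -> : s = \sum_i \sum_q (- T i m q) *:
   contraction_mx M (b, q) (contraction_mx M (b, i) u).
  apply: eq_bigr => i _; rewrite -mulNmx contraction_mxM.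
  by apply: eq_bigr => q _; rewrite mxE.
rewrite {1}exchange_big -sumrN; apply: eq_bigr => i _.
rewrite -sumrN; apply: eq_bigr => q _.
by rewrite contraction_mxC scalerN (Tsym q) Ts (Tsym m).
Qed.

End kaehler_algebra.

(** * Smooth functions and mixed partial derivatives *)

Section line_derivative.
Context {R : realType} {V : normedModType R}.
Implicit Types (f : V -> R) (x v : V).

(** Restriction to a line makes the one-variable theorems available for
    directional derivatives. *)
Lemma is_derive_line f v x (t : R) : derivable f (t *: v + x) v ->
  is_derive t 1 (fun h : R => f (h *: v + x)) ('D_v f (t *: v + x)).
Proof.
move=> df.
have e : (fun h : R => h^-1 *: (f (h *: v + (t *: v + x)) - f (t *: v + x))) =
    (fun h : R => h^-1 *: (f ((h *: 1 + t) *: v + x) - f (t *: v + x))).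
  by apply/funext => h; rewrite addrA -scalerDl [h *: 1]mulr1.
have eD : 'D_1 (fun h : R => f (h *: v + x)) t = 'D_v f (t *: v + x).
  by rewrite /derive /= e.
rewrite -eD; apply: DeriveDef; last by [].
move: df; rewrite /derivable /= e; exact.
Qed.

Lemma derive_comp_line (g : R -> R) f x v : derivable f x v ->
  derivable g (f x) 1 ->
  derivable (g \o f) x v /\ 'D_v (g \o f) x = g^`()%classic (f x) * 'D_v f x.
Proof.
move=> df dg.
have x0 : x = 0 *: v + x by rewrite scale0r add0r.
have h1 : is_derive (0 : R) 1 (fun h : R => f (h *: v + x)) ('D_v f x).
  by rewrite {2}x0; apply: is_derive_line; rewrite -x0.
have dh : derivable (fun h : R => f (h *: v + x)) (0 : R) 1 by exact: ex_derive.
have dg' : derivable g ((fun h : R => f (h *: v + x)) 0) 1 by rewrite -x0.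
have dgf : derivable (g \o (fun h : R => f (h *: v + x))) (0 : R) 1.
  apply/derivable1_diffP; apply: differentiable_comp; exact/derivable1_diffP.
have dgf' : derivable (g \o f) (0 *: v + x) v by rewrite -x0; apply/derivable1P.
have [_ e1] := is_derive_line dgf'.
have [_ e2] := h1.
have e3 := derive1_comp dh dg'.
split; first by rewrite x0.
have -> : 'D_v (g \o f) x = 'D_v (g \o f) (0 *: v + x) by rewrite -x0.
rewrite -e1 -derive1E -e2 -derive1E; apply: etrans e3 _.
by rewrite -x0.
Qed.
End line_derivative.

Section smooth_functions.
Local Open Scope classical_set_scope.
Local Open Scope ring_scope.
Context {R : realType} {n : nat}.
Implicit Types (f g : 'rV[R]_n -> R) (x : 'rV[R]_n) (i j : 'I_n).

(** Orders of differentiability are needed for inductions: the derivative of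
    an inverse or of an exponential involves the function itself. *)
Fixpoint Ck (k : nat) f : Prop :=
  continuous f /\
  if k is k'.+1 then
    forall i, (forall x, derivable f x (delta_mx 0 i)) /\ Ck k' (partial i f)
  else True.

Lemma smoothP f : smooth f <-> forall k, Ck k f.
Proof.
split=> [sf k|Cf].
  elim: k f sf => [|k IH] f sf; first by split=> //; exact: (sf [::]).2.
  split=> [|i]; first exact: (sf [::]).2.
  split=> [x|]; first exact: (sf [::]).1.
  by apply: IH => s; rewrite /partials -foldr_rcons; exact: sf.
move=> s; elim/last_ind: s f Cf => [|s i IH] f Cf.
  by split=> [i x|]; [exact: ((Cf 1%N).2 i).1 | exact: (Cf 0%N).1].
rewrite /partials foldr_rcons; apply: IH => k.
exact: ((Cf k.+1).2 i).2.
Qed.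

Lemma CkS k f : Ck k.+1 f -> Ck k f.
Proof.
elim: k f => [|k IH] f [cf h]; first by [].
by split=> // i; have [d c] := h i; split=> //; exact: IH.
Qed.

Lemma partial_cst i (c : R) : partial i (cst c : 'rV[R]_n -> R) = cst 0.
Proof. by apply/funext => x; rewrite /partial derive_cst. Qed.

Lemma partialD i f g : (forall x, derivable f x (delta_mx 0 i)) ->
  (forall x, derivable g x (delta_mx 0 i)) ->
  partial i (fun x => f x + g x) = (fun x => partial i f x + partial i g x).
Proof. by move=> df dg; apply/funext => x; rewrite /partial -deriveD. Qed.

Lemma partialM i f g : (forall x, derivable f x (delta_mx 0 i)) ->
  (forall x, derivable g x (delta_mx 0 i)) ->
  partial i (fun x => f x * g x) =
  (fun x => partial i f x * g x + f x * partial i g x).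
Proof.
move=> df dg; apply/funext => x; rewrite /partial.
by rewrite [LHS](deriveM (df x) (dg x)) addrC /GRing.scale /= [g x * _]mulrC.
Qed.

Lemma Ck_cst k (c : R) : Ck k (cst c : 'rV[R]_n -> R).
Proof.
elim: k c => [|k IH] c; split=> //; first exact: cst_continuous.
  exact: cst_continuous.
by move=> i; split=> [x|]; [exact: derivable_cst | rewrite partial_cst].
Qed.

Lemma CkD k f g : Ck k f -> Ck k g -> Ck k (fun x => f x + g x).
Proof.
elim: k f g => [|k IH] f g [cf hf] [cg hg]; split=> //.
- by move=> x; apply: continuousD; [exact: cf | exact: cg].
- by move=> x; apply: continuousD; [exact: cf | exact: cg].
move=> i; have [df pf] := hf i; have [dg pg] := hg i; split=> [x|].
  exact: (derivableD (df x) (dg x)).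
by rewrite partialD //; exact: IH.
Qed.

Lemma CkM k f g : Ck k f -> Ck k g -> Ck k (fun x => f x * g x).
Proof.
elim: k f g => [|k IH] f g Cf Cg; have [cf hf] := Cf; have [cg hg] := Cg; split=> //.
- by move=> x; apply: continuousM; [exact: cf | exact: cg].
- by move=> x; apply: continuousM; [exact: cf | exact: cg].
move=> i; have [df pf] := hf i; have [dg pg] := hg i; split=> [x|].
  exact: (derivableM (df x) (dg x)).
by rewrite partialM //; apply: CkD; apply: IH => //; exact: CkS.
Qed.

Lemma partialV i f : (forall x, f x != 0) ->
  (forall x, derivable f x (delta_mx 0 i)) ->
  partial i (fun x => (f x)^-1) = (fun x => - 1 * (f x)^-1 * (f x)^-1 * partial i f x).
Proof.
move=> f0 df; apply/funext => x; rewrite /partial deriveV // /GRing.scale /=.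
by rewrite -exprVn expr2; ring.
Qed.

Lemma CkV k f : (forall x, f x != 0) -> Ck k f -> Ck k (fun x => (f x)^-1).
Proof.
move=> f0; elim: k => [|k IH] Cf; have [cf hf] := Cf; split=> //.
- by move=> x; apply: continuousV => //; exact: cf.
- by move=> x; apply: continuousV => //; exact: cf.
move=> i; have [df pf] := hf i; split=> [x|]; first exact: (derivableV (f0 x) (df x)).
rewrite partialV //; apply: CkM => //.
have h := IH (CkS Cf).
by apply: (CkM (CkM _ h) h); exact: Ck_cst.
Qed.

Lemma partial_expR i f : (forall x, derivable f x (delta_mx 0 i)) ->
  partial i (fun x => expR (f x)) = (fun x => expR (f x) * partial i f x).
Proof.
move=> df; apply/funext => x; rewrite /partial.
have [_ e] := derive_comp_line (df x) (@derivable_expR _ (f x)).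
by rewrite [LHS]e derive1E; congr (_ * _); exact: derive_val.
Qed.

Lemma Ck_expR k f : Ck k f -> Ck k (fun x => expR (f x)).
Proof.
elim: k => [|k IH] Cf; have [cf hf] := Cf; split=> //.
- by move=> x; apply: continuous_comp; [exact: cf | exact: continuous_expR].
- by move=> x; apply: continuous_comp; [exact: cf | exact: continuous_expR].
move=> i; have [df pf] := hf i; split=> [x|].
  exact: (derive_comp_line (df x) (@derivable_expR _ (f x))).1.
by rewrite partial_expR //; apply: CkM => //; apply: IH; exact: CkS.
Qed.

Lemma smooth_continuous f : smooth f -> continuous f.
Proof. by move=> sf; exact: (sf [::]).2. Qed.

Lemma smooth_derivable f i x : smooth f -> derivable f x (delta_mx 0 i).
Proof. by move=> sf; exact: (sf [::]).1. Qed.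

Lemma smooth_partial i f : smooth f -> smooth (partial i f).
Proof. by move=> sf s; rewrite /partials -foldr_rcons; exact: sf. Qed.

Lemma smooth_cst (c : R) : smooth (fun _ : 'rV[R]_n => c).
Proof. by apply/smoothP => k; exact: Ck_cst. Qed.

Lemma smoothD f g : smooth f -> smooth g -> smooth (fun x => f x + g x).
Proof. by move=> /smoothP hf /smoothP hg; apply/smoothP => k; exact: CkD. Qed.

Lemma smoothM f g : smooth f -> smooth g -> smooth (fun x => f x * g x).
Proof. by move=> /smoothP hf /smoothP hg; apply/smoothP => k; exact: CkM. Qed.

Lemma smoothV f : (forall x, f x != 0) -> smooth f -> smooth (fun x => (f x)^-1).
Proof. by move=> f0 /smoothP hf; apply/smoothP => k; exact: CkV. Qed.

Lemma smooth_expR f : smooth f -> smooth (fun x => expR (f x)).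
Proof. by move=> /smoothP hf; apply/smoothP => k; exact: Ck_expR. Qed.

Lemma smoothN f : smooth f -> smooth (fun x => - f x).
Proof.
move=> sf; have := smoothM (smooth_cst (-1)) sf.
by under eq_fun do rewrite mulN1r.
Qed.

Lemma smooth_sum (I : Type) (r : seq I) (P : pred I) (F : I -> 'rV[R]_n -> R) :
  (forall k, smooth (F k)) -> smooth (fun x => \sum_(k <- r | P k) F k x).
Proof.
move=> sF; elim: r => [|a r IH].
  by under eq_fun do rewrite big_nil; exact: smooth_cst.
under eq_fun do rewrite big_cons; case: (P a) => //; exact: smoothD.
Qed.

Lemma smooth_prod (I : Type) (r : seq I) (P : pred I) (F : I -> 'rV[R]_n -> R) :
  (forall k, smooth (F k)) -> smooth (fun x => \prod_(k <- r | P k) F k x).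
Proof.
move=> sF; elim: r => [|a r IH].
  by under eq_fun do rewrite big_nil; exact: smooth_cst.
under eq_fun do rewrite big_cons; case: (P a) => //; exact: smoothM.
Qed.

Lemma partial_sum i (I : Type) (r : seq I) (P : pred I) (F : I -> 'rV[R]_n -> R) :
  (forall k, smooth (F k)) ->
  partial i (fun x => \sum_(k <- r | P k) F k x) =
  (fun x => \sum_(k <- r | P k) partial i (F k) x).
Proof.
move=> sF; elim: r => [|a r IH].
  under eq_fun do rewrite big_nil.
  by rewrite [LHS]partial_cst; apply/funext => x; rewrite big_nil.
under eq_fun do rewrite big_cons; under [RHS]eq_fun do rewrite big_cons.
case: (P a) => //; rewrite partialD ?IH // => x.
  exact: smooth_derivable.
by apply: smooth_derivable; exact: smooth_sum.
Qed.

Lemma partialZ i (c : R) f : smooth f ->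
  partial i (fun x => c * f x) = (fun x => c * partial i f x).
Proof.
move=> sf; rewrite partialM => [||x]; last exact: smooth_derivable.
  by apply/funext => x; rewrite [partial _ _ x]derive_cst mul0r add0r.
by move=> x; exact: derivable_cst.
Qed.

Lemma partialN i f : smooth f -> partial i (fun x => - f x) = (fun x => - partial i f x).
Proof.
move=> sf; under eq_fun do rewrite -mulN1r.
by rewrite partialZ //; apply/funext => x; rewrite mulN1r.
Qed.

(** The mean value theorem is applied to s |-> f (s e_i + h e_j + x) - f (s
    e_i + x), and then in direction j to the derivative of f in direction i.
    *)
Lemma second_difference i j f x (h : R) : smooth f -> 0 < h ->
  exists s t : R, [/\ 0 <= s <= h, 0 <= t <= h &
   f (h *: delta_mx 0 i + (h *: delta_mx 0 j + x)) - f (h *: delta_mx 0 i + x)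
   - (f (h *: delta_mx 0 j + x) - f x) =
   partial j (partial i f) (t *: delta_mx 0 j + (s *: delta_mx 0 i + x)) * h * h].
Proof.
move=> sf h0.
have line k g y (t : R) : smooth g ->
   is_derive t 1 (fun t : R => g (t *: delta_mx 0 k + y)) (partial k g (t *: delta_mx 0 k + y)).
  by move=> sg; apply: is_derive_line; exact: smooth_derivable.
have linec k g y : smooth g ->
   {within `[0, h], continuous (fun t : R => g (t *: delta_mx 0 k + y))}.
  move=> sg; apply: derivable_within_continuous => t _.
  by have [] := line k g y t sg.
pose F (s : R) := f (s *: delta_mx 0 i + (h *: delta_mx 0 j + x)) - f (s *: delta_mx 0 i + x).
have dF (s : R) : is_derive s 1 F (partial i f (s *: delta_mx 0 i + (h *: delta_mx 0 j + x))
    - partial i f (s *: delta_mx 0 i + x)).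
  by apply: is_deriveB; exact: line.
have cF : {within `[0, h], continuous F}.
  by apply: derivable_within_continuous => s _; have [] := dF s.
have [s sI Fs] := MVT h0 (fun s _ => dF s) cF.
have sp := smooth_partial i sf.
have [t tI Ft] := MVT h0 (fun t _ => line j _ (s *: delta_mx 0 i + x) t sp)
  (linec j _ (s *: delta_mx 0 i + x) sp).
have closed_itv (u : R) : u \in `]0, h[ -> 0 <= u <= h.
  by rewrite in_itv => /andP[u0 uh]; rewrite !ltW.
exists s, t; split; [exact: closed_itv|exact: closed_itv|].
move: Fs; rewrite /F !scale0r !add0r subr0 => ->; congr (_ * _).
by move: Ft; rewrite !scale0r !add0r subr0 addrCA.
Qed.

Lemma no_midpoint (a b p : R) : `|a - p| < `|a - b| / 2 ->
  `|b - p| < `|a - b| / 2 -> False.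
Proof.
rewrite [`|b - p|]distrC => l1 l2.
have : `|a - b| <= `|a - p| + `|p - b| by exact: ler_distD.
by apply/negP; rewrite -ltNge [ltRHS]splitr; exact: ltrD.
Qed.

(** The second difference is symmetric in the two directions, so both mixed
    derivatives take a common value at points arbitrarily close to x;
    continuity concludes. *)
Lemma partialC i j f : smooth f ->
  partial i (partial j f) = partial j (partial i f).
Proof.
move=> sf; apply/funext => x; apply/eqP; rewrite -subr_eq0 -normr_eq0.
set e := `| _ |; rewrite -[_ == _]negbK; apply/negP => e0.
have {}e0 : 0 < e / 2 by rewrite divr_gt0 // lt_def e0 normr_ge0.
have cij k l : continuous (partial k (partial l f)).
  by apply: smooth_continuous; do 2 apply: smooth_partial.
have /cvgrPdist_lt/(_ _ e0)/nbhs_ballP[d1 /= d10 h1] := cij i j x.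
have /cvgrPdist_lt/(_ _ e0)/nbhs_ballP[d2 /= d20 h2] := cij j i x.
pose c : R := `|delta_mx 0 i : 'rV[R]_n| + `|delta_mx 0 j : 'rV[R]_n| + 1.
have c0 : 0 < c by rewrite ltr_wpDl // addr_ge0.
pose d := Num.min d1 d2; have d0 : 0 < d by rewrite lt_min d10.
(* small enough for the rectangle of side h at x to lie in both balls *)
have [h h0 dE] : exists2 h : R, 0 < h & d = h * c.
  by exists (d / c); rewrite ?divr_gt0 // divfK ?gt_eqF.
have inball (s t : R) : 0 <= s <= h -> 0 <= t <= h ->
    `|s *: delta_mx 0 i + t *: delta_mx 0 j : 'rV[R]_n| < d.
  move=> /andP[s0 sh] /andP[t0 th]; apply: le_lt_trans (ler_normD _ _) _.
  rewrite !normrZ !ger0_norm // dE /c !mulrDr mulr1 ltr_pwDr // lerD // ler_wpM2r //.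
have ball1 (s t : R) : 0 <= s <= h -> 0 <= t <= h ->
    ball x d (t *: delta_mx 0 j + (s *: delta_mx 0 i + x)).
  move=> hs ht; rewrite -ball_normE /ball_ /= addrA [t *: _ + _]addrC.
  by rewrite opprD addrCA subrr addr0 normrN; exact: inball.
have ball2 (s t : R) : 0 <= s <= h -> 0 <= t <= h ->
    ball x d (s *: delta_mx 0 i + (t *: delta_mx 0 j + x)).
  by move=> hs ht; rewrite addrCA; exact: ball1.
have [s [t [hs ht E1]]] := second_difference i j x sf h0.
have [t' [s' [ht' hs' E2]]] := second_difference j i x sf h0.
have hn0 : h != 0 by rewrite gt_eqF.
have /(mulIf hn0)/(mulIf hn0) E :
    partial j (partial i f) (t *: delta_mx 0 j + (s *: delta_mx 0 i + x)) * h * h =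
    partial i (partial j f) (s' *: delta_mx 0 i + (t' *: delta_mx 0 j + x)) * h * h.
  apply: etrans (esym E1) _; apply: etrans _ E2.
  rewrite [in RHS](addrCA (h *: delta_mx 0 j) (h *: delta_mx 0 i)).
  have swap (a b c' d' : R) : a - b - (c' - d') = a - c' - (b - d') by ring.
  exact: swap.
have := h2 _ (le_ball _ (ball1 _ _ hs ht)).
have := h1 _ (le_ball _ (ball2 _ _ hs' ht')).
rewrite !ge_min !lexx orbT /= -E => /(_ isT) l1 /(_ isT) l2.
exact: no_midpoint l1 l2.
Qed.
End smooth_functions.

(** * Integration over R^n and the divergence theorem *)

Section measurability.
Context {R : realType}.
Local Open Scope classical_set_scope.
Local Open Scope ring_scope.

Definition tuple_row n (t : n.-tuple (measurableTypeR R)) : 'rV[R]_n :=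
  \row_i tnth t i.

(** Supports are measured by the sup norm, which is easier to propagate
    through operations than the compactness of a closure. *)
Definition supported n (r : R) (f : 'rV[R]_n -> R) :=
  forall x, r < `|x| -> f x = 0.

Lemma norm_coord n (x : 'rV[R]_n) i : `|x 0 i| <= `|x|.
Proof.
rewrite [`|x|]mx_normrE.
exact: (le_bigmax _ (fun ij : 'I_1 * 'I_n => `|x ij.1 ij.2|) (0, i)).
Qed.

Lemma norm_row_le n (x : 'rV[R]_n) (r : R) : 0 <= r ->
  (forall i, `|x 0 i| <= r) -> `|x| <= r.
Proof.
move=> r0 h; rewrite [`|x|]mx_normrE; apply: bigmax_le => // -[i j] _ /=.
by rewrite (ord1 i).
Qed.

Lemma measurable_floor_cell n (k : nat) (z : 'I_n -> int) :
  measurable [set t : n.-tuple (measurableTypeR R) |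
    forall i, Num.floor (tnth t i * k.+1%:R) = z i].
Proof.
have -> : [set t : n.-tuple (measurableTypeR R) |
    forall i, Num.floor (tnth t i * k.+1%:R : R) = z i] =
    \bigcap_(i in [set: 'I_n]) ((fun t => tnth t i) @^-1`
      `[(z i)%:~R / k.+1%:R, (z i + 1)%:~R / k.+1%:R[).
  have k0 : (0 : R) < k.+1%:R by rewrite ltr0n.
  apply/seteqP; split=> t /= h i => [_|].
    have := floor_itv (tnth t i * k.+1%:R : R).
    by rewrite h /= in_itv /= ler_pdivrMr // ltr_pdivlMr.
  apply: floor_def; have := h i I.
  by rewrite /= in_itv /= ler_pdivrMr // ltr_pdivlMr.
apply: fin_bigcap_measurable => // i _.
rewrite -[X in measurable X]setTI; apply: measurable_tnth => //.
Qed.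

(** The sigma-algebra of tuples is generated by the coordinates and bears no
    relation to a topology. A continuous function is the pointwise limit of
    its values at the points of finer and finer grids, and each approximation
    depends on countably many cells. *)
Lemma measurable_continuous_row n (f : 'rV[R]_n -> R) : continuous f ->
  measurable_fun setT (f \o @tuple_row n).
Proof.
move=> cf.
pose q (k : nat) (z : {ffun 'I_n -> int}) : 'rV[R]_n :=
  \row_i ((z i)%:~R / k.+1%:R).
pose fl (k : nat) (t : n.-tuple (measurableTypeR R)) : {ffun 'I_n -> int} :=
  [ffun i => Num.floor (tnth t i * k.+1%:R : R)].
apply: (measurable_realfun.measurable_fun_cvg (h := fun k t => f (q k (fl k t)))) => [k|t _].
  move=> _ B mB; rewrite setTI.
  have -> : (fun t => f (q k (fl k t))) @^-1` B =
     \bigcup_(z : {ffun 'I_n -> int}) (if f (q k z) \in B then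
       [set t | forall i, Num.floor (tnth t i * k.+1%:R : R) = z i] else set0).
    apply/seteqP; split=> [t /= Bt|t [z _]].
      exists (fl k t) => //; rewrite mem_set // => i; by rewrite ffunE.
    case: ifPn => // /set_mem Bz tz /=.
    suff -> : fl k t = z by [].
    by apply/ffunP => i; rewrite ffunE tz.
  apply: countable_bigcupT_measurable => [|z]; first exact: countableP.
  by case: ifP => // _; exact: measurable_floor_cell.
suff h : (fun k => q k (fl k t)) @ \oo --> (tuple_row t : 'rV[R]_n).
  exact: (cvg_comp _ _ h (cf _)).
apply/cvgrPdist_le => e e0; near=> k.
have k0 : (0 : R) < k.+1%:R by rewrite ltr0n.
apply: norm_row_le => [|i]; first exact: ltW.
rewrite !mxE ffunE.
have /andP[l1 l2] := floor_itv (tnth t i * k.+1%:R : R).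
set m := Num.floor _ in l1 l2 *.
have h1 : m%:~R / k.+1%:R <= tnth t i by rewrite ler_pdivrMr.
rewrite ger0_norm ?subr_ge0 //.
have h2 : tnth t i < (m + 1)%:~R / k.+1%:R by rewrite ltr_pdivlMr.
apply: (@le_trans _ _ (k.+1%:R^-1)).
  rewrite lerBlDr; apply: ltW; apply: (lt_le_trans h2).
  by rewrite intrD mulrDl mul1r addrC.
near: k.
have /cvgrPdist_le/(_ _ e0) := @cvg_harmonic R.
by apply: filterS => k; rewrite sub0r normrN /harmonic /= ger0_norm.
Unshelve. all: by end_near. Qed.
End measurability.

Section integrability.
Context {R : realType}.
Local Open Scope classical_set_scope.
Local Open Scope ring_scope.

Definition box n (r : R) : set (n.-tuple (measurableTypeR R)) :=
  [set t | forall i, `|tnth t i| <= r].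

Lemma measurable_box n r : measurable (@box n r).
Proof.
have -> : @box n r =
    \bigcap_(i in [set: 'I_n]) ((fun t => tnth t i) @^-1` `[(- r), r]).
  by apply/seteqP; split=> t h i => [_|]; have := h i; rewrite /= in_itv /= ler_norml //; apply.
apply: fin_bigcap_measurable => // i _.
by rewrite -[X in measurable X]setTI; apply: measurable_tnth.
Qed.

Lemma box_finite n r : (lebesgue_tuple R n (@box n r) < +oo)%E.
Proof.
elim: n => [|n IH].
  by rewrite /= diracE; case: (_ \in _) => //=; rewrite ltry.
have -> : lebesgue_tuple R n.+1 (box r) =
    (lebesgue_measure \x lebesgue_tuple R n)%E (@tuple_cons _ _ n @^-1` box r).
  by [].
have -> : (@tuple_cons _ _ n @^-1` box r) =
          `[(- r), r]%classic `*` box r.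
  apply/seteqP; split=> [[x t] h|[x t] [/= hx ht] i].
    split=> [|i]; first by have := h ord0; rewrite /= in_itv /= ler_norml tnth0.
    by have := h (lift ord0 i); rewrite tnthS.
  case: (unliftP ord0 i) => [j ->|->]; rewrite ?tnthS ?tnth0 //.
  by move: hx; rewrite in_itv /= ler_norml.
rewrite product_measure1E //; last exact: measurable_box.
rewrite lte_mul_pinfty //.
suff : @lebesgue_measure R `[(- r), r]%classic \is a fin_num by [].
by rewrite lebesgue_measure_itv /=; case: ifP.
Qed.

Lemma integrable_supported n (f : 'rV[R]_n -> R) (r : R) :
  0 <= r -> continuous f -> supported r f ->
  (lebesgue_tuple R n).-integrable setT (EFin \o (f \o @tuple_row R n)).
Proof.
move=> r0 cf sf.
have fbox : EFin \o (f \o @tuple_row R n) =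
    (EFin \o (f \o @tuple_row R n)) \_ (@box n r).
  apply/funext => t; rewrite /patch; case: ifPn => //= /negP tb.
  congr (_%:E); apply: sf; rewrite ltNge; apply/negP => h; apply: tb.
  apply/mem_set => i; have := le_trans (norm_coord (tuple_row t) i) h.
  by rewrite mxE.
rewrite fbox; apply: (integrable_mkcond _ (@measurable_box n r)).1.
apply: measurable_bounded_integrable.
- exact: measurable_box.
- exact: box_finite.
- by apply: measurable_funTS; exact: measurable_continuous_row.
have cK : compact [set x : 'rV[R]_n | `|x| <= r].
  apply: bounded_closed_compact.
    exists r; split; first exact: num_real.
    by move=> M rM x /= xr; exact: le_trans xr (ltW rM).
  apply: (@closed_comp _ _ (fun x : 'rV[R]_n => `|x|) [set y | y <= r]).
    by move=> x _; exact: norm_continuous.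
  exact: closed_le.
have [M [Mr hM]] := compact_bounded (continuous_compact (continuous_subspaceT cf) cK).
exists M; split=> // C MC t tb /=; apply: hM => //; exists (tuple_row t) => //=.
by apply: norm_row_le => // i; rewrite mxE; exact: tb.
Qed.

End integrability.

Section divergence.
Context {R : realType}.
Local Open Scope classical_set_scope.
Local Open Scope ring_scope.

Lemma supported_partial n (r : R) i (f : 'rV[R]_n -> R) :
  supported r f -> supported r (partial i f).
Proof.
move=> sf x rx; rewrite /partial.
have -> : 'D_(delta_mx 0 i) f x = 'D_(delta_mx 0 i) (cst 0 : 'rV[R]_n -> R) x.
  apply: near_eq_derive; have := @norm_continuous _ _ x.
  move=> /(_ [set y : R | r < y]); rewrite /nbhs /= => h.
  near=> y; apply: sf; near: y; apply: h.
  exact: lt_nbhsr.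
by rewrite derive_cst.
Unshelve. all: by end_near. Qed.

Definition cons_row n (x : R) (y : 'rV[R]_n) : 'rV[R]_n.+1 :=
  \row_i (if unlift ord0 i is Some j then y 0 j else x).

Lemma cons_row0 n (x : R) (y : 'rV[R]_n) :
  cons_row x y = x *: delta_mx 0 ord0 + cons_row 0 y.
Proof.
apply/rowP => i; rewrite !mxE; case: unliftP => [j ->|->] /=.
  by rewrite mulr0 add0r.
by rewrite ?eqxx mulr1 addr0.
Qed.

Lemma cons_row_line n (x h : R) (y : 'rV[R]_n) j :
  cons_row x (h *: delta_mx 0 j + y) =
  h *: delta_mx 0 (lift ord0 j) + cons_row x y.
Proof.
apply/rowP => i; rewrite !mxE; case: unliftP => [k ->|->] /=.
  by rewrite !mxE (inj_eq lift_inj).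
by rewrite mulr0 add0r.
Qed.

Lemma cons_row_tuple n x (t : n.-tuple (measurableTypeR R)) :
  tuple_row (tuple_cons (x, t)) = cons_row x (tuple_row t).
Proof.
apply/rowP => i; rewrite !mxE; case: unliftP => [k ->|->] /=.
  by rewrite tnthS mxE.
by rewrite tnth0.
Qed.

Lemma continuous_cons_row n (x : R) : continuous (@cons_row n x).
Proof.
move=> y A /= /nbhs_ballP[e e0 yA]; apply/nbhs_ballP; exists e => //= z [_ yz].
apply: yA; split=> // i k; rewrite (ord1 i) !mxE.
by case: unliftP => [l _|_]; [exact: yz | exact: ballxx].
Qed.

Lemma continuous_cons_row0 n (y : 'rV[R]_n) : continuous (fun x : R => cons_row x y).
Proof.
move=> x A /= /nbhs_ballP[e e0 yA]; apply/nbhs_ballP; exists e => //= z xz.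
apply: yA; split=> // i k; rewrite (ord1 i) !mxE.
by case: unliftP => [l _|_]; [exact: ballxx | exact: xz].
Qed.

Lemma norm_cons_row n (x : R) (y : 'rV[R]_n) : `|y| <= `|cons_row x y|.
Proof.
apply: norm_row_le => // i; have := norm_coord (cons_row x y) (lift ord0 i).
by rewrite mxE liftK.
Qed.

Lemma norm_cons_row0 n (x : R) (y : 'rV[R]_n) : `|x| <= `|cons_row x y|.
Proof.
by have := norm_coord (cons_row x y) ord0; rewrite mxE unlift_none.
Qed.

(** The fundamental theorem of calculus on an interval whose end points lie
    outside the support. *)
Lemma integral_derivative0 (F f : R -> R) (r : R) : 0 <= r ->
  (forall x : R, is_derive x (1 : R) F (f x)) -> continuous f ->
  (forall x : R, r < `|x| -> F x = 0) -> (forall x : R, r < `|x| -> f x = 0) ->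
  (\int[lebesgue_measure]_x (f x)%:E = 0)%E.
Proof.
move=> r0 dF cf F0 f0.
have fE : (fun x => (f x)%:E) = (EFin \o f) \_ `[- (r + 1), r + 1].
  apply/funext => x; rewrite /patch; case: ifPn => //= /negP xr.
  congr (_%:E); apply: f0; rewrite ltNge; apply/negP => h; apply: xr.
  apply/mem_set; rewrite /= in_itv /= -ler_norml (le_trans h) //.
  by rewrite lerDl.
rewrite fE -integral_mkcond.
have dF1 x : derivable F x 1 by have [] := dF x.
have cF : continuous F.
  by move=> x; apply/differentiable_continuous/derivable1_diffP.
have rr1 : r < `|r + 1| by rewrite ger0_norm ?addr_ge0 // ltrDl.
rewrite (@continuous_FTC2 R f F).
- by rewrite !F0 ?normrN ?rr1 // subee.
- by rewrite -subr_gt0 opprK addr_gt0 // ltr_wpDl.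
- exact: continuous_subspaceT.
- split.
  + by move=> x _.
  + exact/cvg_at_right_filter/cF.
  + exact/cvg_at_left_filter/cF.
- by move=> x _; rewrite derive1E; have [_] := dF x.
Qed.

(** By Fubini: if the differentiated variable is the first one, integrate in
    it first; otherwise integrate first in the other variables, by induction.
    *)
Lemma integral_partial0 n (f : 'rV[R]_n -> R) i (r : R) : 0 <= r ->
  (forall x, derivable f x (delta_mx 0 i)) -> continuous (partial i f) ->
  supported r f ->
  (\int[lebesgue_tuple R n]_t (partial i f (tuple_row t))%:E = 0)%E.
Proof.
elim: n f i => [|n IH] f i r0 df cf sf; first by case: i {df cf}.
set g := partial i f in cf *.
have sg : supported r g by exact: supported_partial.
have ig := integrable_supported r0 cf sg.
have mg := measurable_continuous_row cf.
have mcons := @measurable_tuple_cons _ (measurableTypeR R) n.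
pose G (p : measurableTypeR R * n.-tuple (measurableTypeR R)) := (g (cons_row p.1 (tuple_row p.2)))%:E.
have GE : G = (EFin \o (g \o @tuple_row R n.+1)) \o (@tuple_cons _ _ n).
  by apply/funext => -[x t]; rewrite /G /= cons_row_tuple.
have mG : measurable_fun setT G.
  rewrite GE; apply: measurableT_comp => //; exact/measurable_EFinP.
have iG : (@lebesgue_measure R \x lebesgue_tuple R n)%E.-integrable setT G.
  apply/integrableP; split=> //; case/integrableP: ig => _.
  have mabs : measurable_fun setT (fun t : n.+1.-tuple (measurableTypeR R) =>
      `|(EFin \o (g \o @tuple_row R n.+1)) t|%E).
    by apply: measurableT_comp => //; exact/measurable_EFinP.
  have := ge0_integral_pushforward mcons
    (@lebesgue_measure R \x lebesgue_tuple R n)%E measurableT mabs.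
  rewrite preimage_setT GE => h; apply: le_lt_trans; rewrite -h //.
have -> : (\int[lebesgue_tuple R n.+1]_t (g (tuple_row t))%:E =
           \int[(@lebesgue_measure R \x lebesgue_tuple R n)%E]_p G p)%E.
  rewrite GE.
  have mEg : measurable_fun setT (EFin \o (g \o @tuple_row R n.+1)).
    exact/measurable_EFinP.
  have h := @integral_pushforward _ _ _ _ _ _ mcons
    (@lebesgue_measure R \x lebesgue_tuple R n)%E setT _ mEg.
  by apply: h => //; rewrite preimage_setT -GE.
case: (unliftP ord0 i) => [j|] ei.
  rewrite -integral12_prod_meas1 //=.
  apply: integral0_eq => x _; rewrite /fubini_F /G /=.
  have e : g \o cons_row x = partial j (f \o cons_row x).
    apply/funext => y; rewrite /g /partial /derive /= ei.
    by under [in RHS]eq_fun do rewrite cons_row_line.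
  have := IH (f \o cons_row x) j r0; rewrite -e; apply.
  - move=> y; have := df (cons_row x y); rewrite /derivable /= ei.
    by under [in X in _ -> X]eq_fun do rewrite cons_row_line.
  - move=> y; apply: continuous_comp; [exact: continuous_cons_row|exact: cf].
  - by move=> y ry; apply: sf; exact: lt_le_trans ry (norm_cons_row _ _).
rewrite -integral21_prod_meas1 //=.
apply: integral0_eq => t _; rewrite /fubini_G /G /=.
apply: (@integral_derivative0 (fun x => f (cons_row x (tuple_row t)))
   (fun x => g (cons_row x (tuple_row t))) r r0).
- move=> x; rewrite /g /partial cons_row0.
  have -> : (fun x => f (cons_row x (tuple_row t))) =
            (fun h => f (h *: delta_mx 0 i + cons_row 0 (tuple_row t))).
    by apply/funext => h; rewrite cons_row0 ei.
  by rewrite -ei; apply: is_derive_line.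
- move=> x; apply: continuous_comp; last exact: cf.
  exact: continuous_cons_row0.
- by move=> x rx; apply: sf; exact: lt_le_trans rx (norm_cons_row0 _ _).
- by move=> x rx; apply: sg; exact: lt_le_trans rx (norm_cons_row0 _ _).
Qed.

End divergence.

Section test_functions.
Context {R : realType} {n : nat}.
Local Open Scope classical_set_scope.
Local Open Scope ring_scope.
Implicit Types f g : 'rV[R]_n -> R.

Lemma compactly_supportedP f :
  compactly_supported f <-> exists2 r : R, 0 <= r & supported r f.
Proof.
split=> [/compact_bounded[M [_ hM]]|[r r0 sf]].
  exists (`|M| + 1) => [|x Mx]; first by rewrite addr_ge0.
  apply: contrapT => /eqP fx.
  have := hM (`|M| + 1); rewrite (le_lt_trans (ler_norm M)) ?ltrDl // => /(_ isT).
  move=> /(_ x (@subset_closure _ [set y | f y != 0] x fx)) /=.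
  by rewrite leNgt Mx.
have sub : closure [set x | f x != 0] `<=` [set x | `|x| <= r].
  have cl : closed [set x : 'rV[R]_n | `|x| <= r].
    apply: (@closed_comp _ _ (fun x : 'rV[R]_n => `|x|) [set y | y <= r]).
      by move=> x _; exact: norm_continuous.
    exact: closed_le.
  move/closure_id : cl => ->; apply: closureS => x /= fx.
  by rewrite leNgt; apply: contra_neqN fx => /sf.
apply: bounded_closed_compact; last exact: closed_closure.
exists r; split=> [|M rM x /sub /= xr]; first exact: num_real.
exact: le_trans xr (ltW rM).
Qed.

Definition test_fun f := smooth f /\ exists2 r : R, 0 <= r & supported r f.

Lemma test_fun_integrable f : test_fun f ->
  (lebesgue_tuple R n).-integrable setT (EFin \o (f \o @tuple_row R n)).
Proof.
by move=> [sf [r r0 rf]]; apply: integrable_supported rf => //; exact: smooth_continuous.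
Qed.

Lemma integral_RnD f g : test_fun f -> test_fun g ->
  integral_Rn (fun x => f x + g x) = integral_Rn f + integral_Rn g.
Proof.
by move=> tf tg; rewrite /integral_Rn RintegralD //; exact: test_fun_integrable.
Qed.

Lemma integral_RnZ f (c : R) : test_fun f ->
  integral_Rn (fun x => c * f x) = c * integral_Rn f.
Proof.
by move=> tf; rewrite /integral_Rn RintegralZl //; exact: test_fun_integrable.
Qed.

Lemma integral_Rn_partial f i : test_fun f -> integral_Rn (partial i f) = 0.
Proof.
move=> [sf [r r0 rf]]; rewrite /integral_Rn /Rintegral.
have := @integral_partial0 R n f i r r0 (fun x => smooth_derivable (i := i) (x := x) sf)
  (smooth_continuous (smooth_partial i sf)) rf.
by move=> h; rewrite [X in fine X]h.
Qed.

Lemma test_funD f g : test_fun f -> test_fun g -> test_fun (fun x => f x + g x).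
Proof.
move=> [sf [r r0 rf]] [sg [s s0 rg]]; split; first exact: smoothD.
exists (Num.max r s) => [|x]; first by rewrite le_max r0.
by rewrite gt_max => /andP[rx sx]; rewrite rf // rg // addr0.
Qed.

Lemma test_funM f g : smooth f -> test_fun g -> test_fun (fun x => f x * g x).
Proof.
move=> sf [sg [s s0 rg]]; split; first exact: smoothM.
by exists s => // x sx; rewrite rg // mulr0.
Qed.

Lemma test_fun0 : test_fun (fun=> 0).
Proof. by split; [exact: smooth_cst | exists 0]. Qed.

Lemma test_fun_sum (I : Type) (r : seq I) (P : pred I) (F : I -> 'rV[R]_n -> R) :
  (forall k, test_fun (F k)) -> test_fun (fun x => \sum_(k <- r | P k) F k x).
Proof.
move=> tF; elim: r => [|a r IH].
  by under eq_fun do rewrite big_nil; exact: test_fun0.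
under eq_fun do rewrite big_cons; case: (P a) => //; exact: test_funD.
Qed.

Lemma integral_Rn_sum (I : Type) (r : seq I) (F : I -> 'rV[R]_n -> R) :
  (forall k, test_fun (F k)) ->
  integral_Rn (fun x => \sum_(k <- r) F k x) = \sum_(k <- r) integral_Rn (F k).
Proof.
move=> tF; elim: r => [|a r IH].
  under eq_fun do rewrite big_nil; rewrite big_nil.
  apply: etrans (etrans (integral_RnZ 0 test_fun0) (mul0r _)).
  by congr integral_Rn; apply/funext => x; rewrite mul0r.
under eq_fun do rewrite big_cons; rewrite integral_RnD ?IH ?big_cons //.
exact: test_fun_sum.
Qed.

Lemma test_fun_partial i f : test_fun f -> test_fun (partial i f).
Proof.
move=> [sf [r r0 rf]]; split; first exact: smooth_partial.
by exists r => //; exact: supported_partial.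
Qed.

End test_functions.

(** * Pointwise consequences of bidegree and closedness *)

Section pointwise.
Context {R : realType} {n : nat}.
Local Open Scope set_scope.
Implicit Types (p q : bool * 'I_n) (A B M W X Y : 'M[R]_n) (u v w : ext R n).

Lemma creation2_one (i j : 'I_n) :
  creation (false, i) (creation (true, j) (ext_one R n)) =
  ext_basis R ([set i], [set j]).
Proof.
rewrite -(genE (true, j)) /gen /= /dxi.
rewrite [RHS](ext_basis_creation (p := (false, i))); last by rewrite /occ /= inE.
rewrite mode_sign_false /= big1 ?expr0 ?scale1r => [|k ki]; last first.
  by rewrite inE -val_eqE /= ltn_eqF.
congr (creation _ (ext_basis _ _)); congr pair; apply/setP => k; rewrite !inE.
  by rewrite -pair_eqE /pair_eq /= addbb.
by rewrite -pair_eqE /pair_eq /= addbF.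
Qed.

Lemma bidegree11E (omega : superform R n) x : bidegree 1 1 omega ->
  omega x = lefschetz (coef11 omega x) (ext_one R n).
Proof.
move=> om11; apply/ffunP => -[I K].
rewrite /lefschetz sum_ffunE.
have e (i j : 'I_n) : (coef11 omega x i j *: creation (false, i)
      (creation (true, j) (ext_one R n))) (I, K) =
    omega x ([set i], [set j]) * ((I, K) == ([set i], [set j]))%:R.
  by rewrite creation2_one !ffunE mxE.
under eq_bigr do rewrite sum_ffunE.
under eq_bigr do under eq_bigr do rewrite e.
have [/andP[/cards1P[i ->] /cards1P[j ->]]|nIK] :=
    boolP ((#|I| == 1%N) && (#|K| == 1%N)).
  rewrite (bigD1 i) //= (bigD1 j) //= eqxx mulr1.
  rewrite big1 ?addr0 => [|k kj]; last first.
    rewrite -pair_eqE /pair_eq /= eqxx /= (inj_eq set1_inj) eq_sym (negPf kj).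
    by rewrite mulr0.
  rewrite big1 ?addr0 // => k ki; rewrite big1 // => l _.
  by rewrite -pair_eqE /pair_eq /= (inj_eq set1_inj) eq_sym (negPf ki) mulr0.
rewrite om11 //= big1 // => i _; rewrite big1 // => j _.
case: eqP => [[eI eK]|_]; last by rewrite mulr0.
by move: nIK; rewrite eI eK !cards1.
Qed.

Lemma wedge_lefschetz W u :
  wedge (lefschetz W (ext_one R n)) u = lefschetz W u.
Proof.
rewrite /lefschetz wedge_suml; apply: eq_bigr => i _.
rewrite wedge_suml; apply: eq_bigr => j _.
by rewrite wedgeZl !wedge_creation wedge_one.
Qed.

Lemma lefschetz_one_inj W X :
  lefschetz W (ext_one R n) = lefschetz X (ext_one R n) -> W = X.
Proof.
have coef Y i j : lefschetz Y (ext_one R n) ([set i], [set j]) = Y i j.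
  rewrite /lefschetz sum_ffunE (bigD1 i) //= sum_ffunE (bigD1 j) //=.
  rewrite creation2_one !ffunE eqxx [X in X + _ + _]mulr1.
  rewrite big1 ?addr0 => [|k kj]; last first.
    rewrite creation2_one !ffunE -pair_eqE /pair_eq /= !(inj_eq set1_inj).
    by rewrite [j == k]eq_sym (negPf kj) andbF [LHS]mulr0.
  rewrite big1 ?addr0 // => k ki; rewrite sum_ffunE big1 // => l _.
  rewrite creation2_one !ffunE -pair_eqE /pair_eq /= !(inj_eq set1_inj).
  by rewrite [i == k]eq_sym (negPf ki) [LHS]mulr0.
by move=> e; apply/matrixP => i j; rewrite -!coef e.
Qed.

(** The adjoints of the two creations are contractions with M, and M *m W *m M
    = M. *)
Lemma lefschetz_adjoint W u v : posdef W ->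
  super_ip W (lefschetz W u) v = super_ip W u (contraction2 false (invmx W) v).
Proof.
move=> Wpd; have [[ipP ipC _] adj _] := super_ip_spec Wpd.
have [Wsym _] := Wpd.
have Msym : (invmx W)^T = invmx W by rewrite trmx_inv Wsym.
have ip0 w : super_ip W 0 w = 0.
  by have := ipP (-1) 0 0 w; rewrite scaler0 addr0 mulN1r addNr.
have ipsum (F G : 'I_n -> ext R n) w w' :
    (forall j, super_ip W (F j) w = super_ip W w' (G j)) ->
    super_ip W (\sum_j F j) w = super_ip W w' (\sum_j G j).
  move=> FG; rewrite [RHS]ipC.
  elim/big_rec2: _ => [|j y z _ IH]; first by rewrite !ip0.
  by rewrite -[F j]scale1r -[G j]scale1r !ipP IH FG ipC.
have -> : contraction2 false (invmx W) v =
    contraction2 false (invmx W *m W *m invmx W) v.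
  by rewrite mulVmx ?mul1mx // posdef_unitmx.
rewrite contraction2_conj //; apply: (ipsum) => i; apply: ipsum => j.
have ipZ k y z : super_ip W (k *: y) z = k * super_ip W y z.
  by rewrite -[k *: y]addr0 ipP ip0 addr0.
by rewrite ipZ [RHS]ipC ipZ [in RHS]ipC !adj.
Qed.

(** The derivation induced by A on the factors dx. It acts on top coefficients
    by the trace, which gives the derivative of the density of omega^n without
    expanding a determinant. *)
Definition trace_op A u : ext R n :=
  \sum_m creation (false, m) (contraction_mx A (false, m) u).

Lemma trace_op_one A : trace_op A (ext_one R n) = 0.
Proof. by rewrite /trace_op big1 // => m _; rewrite contraction_mx_one creation0. Qed.

Lemma trace_op_lefschetz A W u :
  trace_op A (lefschetz W u) = lefschetz W (trace_op A u) + lefschetz (A *m W) u.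
Proof.
have cc m i j : creation (false, m) (contraction_mx A (false, m)
      (creation (false, i) (creation (true, j) u))) =
    creation (false, i) (creation (true, j)
      (creation (false, m) (contraction_mx A (false, m) u)))
    + A m i *: creation (false, m) (creation (true, j) u).
  rewrite !contraction_mx_creation /= mul0r scale0r sub0r mul1r.
  rewrite creationN opprK creationD creationZ addrC; congr (_ + _).
  rewrite [LHS]creationC [X in - creation _ X]creationC creationN opprK.
  by [].
rewrite /trace_op.
transitivity (\sum_m \sum_i \sum_j W i j *:
   (creation (false, i) (creation (true, j)
      (creation (false, m) (contraction_mx A (false, m) u)))
    + A m i *: creation (false, m) (creation (true, j) u))).
  apply: eq_bigr => m _; rewrite /lefschetz contraction_mx_sum creation_sum.
  apply: eq_bigr => i _; rewrite contraction_mx_sum creation_sum.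
  by apply: eq_bigr => j _; rewrite contraction_mxZ creationZ cc.
have -> : lefschetz W (\sum_m creation (false, m) (contraction_mx A (false, m) u)) =
  \sum_m \sum_i \sum_j W i j *: creation (false, i) (creation (true, j)
      (creation (false, m) (contraction_mx A (false, m) u))).
  rewrite /lefschetz [RHS]exchange_big; apply: eq_bigr => i _.
  rewrite [RHS]exchange_big; apply: eq_bigr => j _.
  by rewrite !creation_sum scaler_sumr.
rewrite -big_split; apply: eq_bigr => m _ /=.
have -> : \sum_j (A *m W) m j *: creation (false, m) (creation (true, j) u) =
    \sum_i \sum_j W i j *: (A m i *: creation (false, m) (creation (true, j) u)).
  rewrite [RHS]exchange_big; apply: eq_bigr => j _.
  rewrite mxE scaler_suml; apply: eq_bigr => i _.
  by rewrite scalerA mulrC.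
rewrite -big_split; apply: eq_bigr => i _ /=.
by rewrite -big_split; apply: eq_bigr => j _ /=; rewrite scalerDr.
Qed.

(** A contraction has no top coefficient, so that only the constant of the
    anticommutation relation remains. *)
Lemma trace_op_top A u :
  trace_op A u (finset.setT, finset.setT) =
  \tr A * u (finset.setT, finset.setT).
Proof.
have top p v : contraction p v (finset.setT, finset.setT) = 0.
  by rewrite ffunE /occ /= if_same inE !mul0r.
rewrite /trace_op sum_ffunE mulr_suml; apply: eq_bigr => m _.
have -> : creation (false, m) (contraction_mx A (false, m) u) =
    A m m *: u - contraction_mx A (false, m) (creation (false, m) u).
  by rewrite contraction_mx_creation /= ?eqxx mul1r subKr.
rewrite !ffunE /contraction_mx sum_ffunE big1 ?subr0 // => j _.
by rewrite ffunE top [LHS]mulr0.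
Qed.

(** The hypothesis is the vanishing of d omega when T k is the k-th derivative
    of the matrix of omega; contracting it by dx_i compares T i with the other
    derivatives. *)
Lemma closed_symmetric (T : 'I_n -> 'M[R]_n) :
  \sum_k creation (false, k) (lefschetz (T k) (ext_one R n)) = 0 ->
  forall i j k, T i j k = T j i k.
Proof.
move=> cl i.
suff : lefschetz (T i) (ext_one R n) =
    lefschetz (\matrix_(j, k) T j i k) (ext_one R n).
  by move=> /lefschetz_one_inj -> j k; rewrite mxE.
have := congr1 (contraction (false, i)) cl.
rewrite contraction0 contraction_sum.
under eq_bigr do rewrite contraction_creation.
rewrite sumrB (bigD1 i) //= eqxx scale1r big1 ?addr0 => [|k ki]; last first.
  by rewrite -pair_eqE /pair_eq /= eq_sym (negPf ki) scale0r.
move/eqP; rewrite subr_eq0 => /eqP ->.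
rewrite [RHS]/lefschetz; apply: eq_bigr => k _.
rewrite /lefschetz contraction_sum creation_sum (bigD1 i) //=.
rewrite [X in _ + X]big1 ?addr0 => [|l li]; last first.
  rewrite contraction_sum creation_sum big1 // => j _.
  rewrite contractionZ !contraction_creation contraction_one creation0 subr0.
  rewrite -!pair_eqE /pair_eq /= [i == l]eq_sym (negPf li) !scale0r.
  by rewrite creation0 subr0 scaler0 creation0.
rewrite contraction_sum creation_sum; apply: eq_bigr => j _.
rewrite contractionZ !contraction_creation contraction_one creation0 subr0.
by rewrite eqxx -!pair_eqE /pair_eq /= scale1r !scale0r creation0 subr0 creationZ mxE.
Qed.

End pointwise.

(** * Calculus of smooth forms *)

Section form_calculus.
Context {R : realType} {n : nat}.
Implicit Types (alpha beta : superform R n) (f g : 'rV[R]_n -> R) (x : 'rV[R]_n).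
Implicit Types (i j : 'I_n).

Lemma smooth_partial_form i alpha : smooth_form alpha ->
  smooth_form (partial_form i alpha).
Proof.
move=> sa S; have := smooth_partial i (sa S).
by congr smooth; apply/funext => x; rewrite ffunE.
Qed.

Lemma linear_coef (l : {linear ext R n -> ext R n}) (u : ext R n) S :
  l u S = \sum_T l (ext_basis R T) S * u T.
Proof.
rewrite [in LHS](ext_basisE u) linear_sum sum_ffunE; apply: eq_bigr => T _.
by rewrite linearZ /= ffunE [LHS]mulrC.
Qed.

Section combination.
Variables (I : finType) (c : I -> 'rV[R]_n -> R)
  (l : I -> {linear ext R n -> ext R n}) (alpha : superform R n).
Hypotheses (sc : forall k, smooth (c k)) (sa : smooth_form alpha).

Let coefE x S : (\sum_k c k x *: l k (alpha x)) S =
  \sum_k \sum_T l k (ext_basis R T) S * (c k x * alpha x T).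
Proof.
rewrite sum_ffunE; apply: eq_bigr => k _; rewrite ffunE linear_coef.
by rewrite [LHS]mulr_sumr; apply: eq_bigr => T _; rewrite [LHS]mulrCA.
Qed.

Lemma smooth_form_comb : smooth_form (fun x => \sum_k c k x *: l k (alpha x)).
Proof.
move=> S; under eq_fun do rewrite coefE.
apply: smooth_sum => k; apply: smooth_sum => T.
by apply: smoothM; [exact: smooth_cst | apply: smoothM].
Qed.

(** The Leibniz rule for an operator with variable coefficients c and constant
    linear parts l. The operators L and Lambda have this shape. *)
Lemma partial_form_comb i x :
  partial_form i (fun x => \sum_k c k x *: l k (alpha x)) x =
  \sum_k (partial i (c k) x *: l k (alpha x) +
          c k x *: l k (partial_form i alpha x)).
Proof.
apply/ffunP => S; rewrite ffunE; under eq_fun do rewrite coefE.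
have sT k T : smooth (fun x => l k (ext_basis R T) S * (c k x * alpha x T)).
  by apply: smoothM; [exact: smooth_cst | apply: smoothM].
rewrite partial_sum => [|k]; last by apply: smooth_sum => T; exact: sT.
rewrite sum_ffunE; apply: eq_bigr => k _.
rewrite partial_sum => [|T]; last exact: sT.
rewrite !ffunE !linear_coef [X in _ = X + _]mulr_sumr [X in _ = _ + X]mulr_sumr.
rewrite -big_split; apply: eq_bigr => T _ /=.
rewrite partialZ; last exact: smoothM.
rewrite partialM; try by move=> y; exact: smooth_derivable.
by rewrite ffunE mulrDr; congr (_ + _); exact: mulrCA.
Qed.
End combination.

Lemma smooth_form_sum (I : finType) (F : I -> superform R n) :
  (forall k, smooth_form (F k)) -> smooth_form (fun x => \sum_k F k x).
Proof.
move=> sF S; under eq_fun do rewrite sum_ffunE.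
by apply: smooth_sum => k; exact: sF.
Qed.

Lemma partial_form_sum (I : finType) (F : I -> superform R n) i x :
  (forall k, smooth_form (F k)) ->
  partial_form i (fun x => \sum_k F k x) x = \sum_k partial_form i (F k) x.
Proof.
move=> sF; apply/ffunP => S; rewrite sum_ffunE ffunE.
under eq_fun do rewrite sum_ffunE.
rewrite partial_sum => [|k]; last exact: sF.
by apply: eq_bigr => k _; rewrite ffunE.
Qed.

Lemma smooth_form_lin (l : {linear ext R n -> ext R n}) alpha :
  smooth_form alpha -> smooth_form (fun x => l (alpha x)).
Proof.
move=> sa S; under eq_fun do rewrite linear_coef.
by apply: smooth_sum => T; apply: smoothM => //; exact: smooth_cst.
Qed.

Lemma partial_form_lin (l : {linear ext R n -> ext R n}) alpha i x :
  smooth_form alpha ->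
  partial_form i (fun x => l (alpha x)) x = l (partial_form i alpha x).
Proof.
move=> sa; apply/ffunP => S; rewrite ffunE; under eq_fun do rewrite linear_coef.
rewrite partial_sum => [|T]; last by apply: smoothM => //; exact: smooth_cst.
rewrite linear_coef; apply: eq_bigr => T _.
by rewrite partialZ // ffunE.
Qed.

Lemma smooth_form_scale f alpha : smooth f -> smooth_form alpha ->
  smooth_form (scale_form f alpha).
Proof.
move=> sf sa S; have := smoothM sf (sa S).
by congr smooth; apply/funext => x; rewrite ffunE.
Qed.

Lemma partial_form_scale f alpha i x : smooth f -> smooth_form alpha ->
  partial_form i (scale_form f alpha) x =
  partial i f x *: alpha x + f x *: partial_form i alpha x.
Proof.
move=> sf sa; apply/ffunP => S; rewrite !ffunE.
have -> : (fun y => scale_form f alpha y S) = (fun y => f y * alpha y S).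
  by apply/funext => y; rewrite ffunE.
by rewrite partialM // => y; exact: smooth_derivable.
Qed.

Lemma smooth_formD alpha beta : smooth_form alpha -> smooth_form beta ->
  smooth_form (fun x => alpha x + beta x).
Proof.
move=> sa sb S; have := smoothD (sa S) (sb S).
by congr smooth; apply/funext => x; rewrite ffunE.
Qed.

Lemma smooth_formN alpha : smooth_form alpha -> smooth_form (fun x => - alpha x).
Proof.
move=> sa S; have := smoothN (sa S).
by congr smooth; apply/funext => x; rewrite ffunE.
Qed.

Lemma partial_formD alpha beta i x : smooth_form alpha -> smooth_form beta ->
  partial_form i (fun x => alpha x + beta x) x =
  partial_form i alpha x + partial_form i beta x.
Proof.
move=> sa sb; apply/ffunP => S; rewrite !ffunE.
under eq_fun do rewrite ffunE.
by rewrite partialD // => y; exact: smooth_derivable.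
Qed.

Lemma partial_formN alpha i x : smooth_form alpha ->
  partial_form i (fun x => - alpha x) x = - partial_form i alpha x.
Proof.
move=> sa; apply/ffunP => S; rewrite !ffunE.
by under eq_fun do rewrite ffunE; rewrite partialN.
Qed.

Definition supp_form (r : R) alpha := forall x, r < `|x| -> alpha x = 0.

Lemma supp_partial_form (r : R) i alpha : supp_form r alpha ->
  supp_form r (partial_form i alpha).
Proof.
move=> sa x rx; apply/ffunP => S; rewrite !ffunE.
apply: (@supported_partial _ _ r) => // y ry; by rewrite sa // ffunE.
Qed.

Lemma test_formP alpha :
  test_form alpha <-> smooth_form alpha /\ exists2 r : R, 0 <= r & supp_form r alpha.
Proof.
split=> [[sa ca]|[sa [r r0 ra]]]; split=> //; last first.
  move=> S; apply/compactly_supportedP; exists r => // x rx.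
  by rewrite ra // ffunE.
have /choice[r hr] : forall S, exists r : R,
    0 <= r /\ supported r (fun x => alpha x S).
  by move=> S; have /compactly_supportedP[r r0 sr] := ca S; exists r.
exists (\sum_S r S) => [|x rx]; first by apply: sumr_ge0 => S _; case: (hr S).
apply/ffunP => S; rewrite ffunE; apply: (hr S).2; apply: le_lt_trans rx.
by rewrite (bigD1 S) //= lerDl sumr_ge0 // => T _; case: (hr T).
Qed.

(** This is d for b = false and d# for b = true. *)
Definition super_d (b : bool) alpha : superform R n :=
  fun x => \sum_i creation (b, i) (partial_form i alpha x).

Lemma ext_dE alpha : ext_d alpha = super_d false alpha.
Proof. by apply/funext => x; apply: eq_bigr => i _; rewrite wedge_dx. Qed.

Lemma ext_dsharpE alpha : ext_dsharp alpha = super_d true alpha.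
Proof. by apply/funext => x; apply: eq_bigr => i _; rewrite wedge_dxi. Qed.

Lemma smooth_super_d b alpha : smooth_form alpha -> smooth_form (super_d b alpha).
Proof.
move=> sa; apply: smooth_form_sum => i.
by apply: (smooth_form_lin (creation (b, i))); exact: smooth_partial_form.
Qed.

Lemma supp_super_d (r : R) b alpha : supp_form r alpha -> supp_form r (super_d b alpha).
Proof.
move=> sa x rx; rewrite /super_d big1 // => i _.
by rewrite (supp_partial_form i sa) // creation0.
Qed.

Lemma test_super_d b alpha : test_form alpha -> test_form (super_d b alpha).
Proof.
move/test_formP=> [sa [r r0 ra]]; apply/test_formP; split; first exact: smooth_super_d.
by exists r => //; exact: supp_super_d.
Qed.

Lemma test_scale f alpha : smooth f -> test_form alpha ->
  test_form (scale_form f alpha).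
Proof.
move=> sf /test_formP[sa [r r0 ra]]; apply/test_formP.
split; first exact: smooth_form_scale.
by exists r => // x rx; rewrite /scale_form ra // scaler0.
Qed.

Lemma test_formD alpha beta : test_form alpha -> test_form beta ->
  test_form (fun x => alpha x + beta x).
Proof.
move=> /test_formP[sa [r r0 ra]] /test_formP[sb [s s0 rb]]; apply/test_formP.
split; first exact: smooth_formD.
exists (Num.max r s) => [|x]; first by rewrite le_max r0.
by rewrite gt_max => /andP[rx sx]; rewrite ra // rb // addr0.
Qed.

Lemma test_formN alpha : test_form alpha -> test_form (fun x => - alpha x).
Proof.
move=> /test_formP[sa [r r0 ra]]; apply/test_formP; split; first exact: smooth_formN.
by exists r => // x rx; rewrite ra // oppr0.
Qed.

End form_calculus.

(** * Derivatives of the metric and of the volume density *)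

Section kaehler.
Context {R : realType} {n : nat}.
Variable omega : superform R n.
Hypotheses (omega_smooth : smooth_form omega) (omega11 : bidegree 1 1 omega)
  (omega_closed : closed_form omega) (omega_pos : positive11 omega).
Implicit Types (alpha beta : superform R n) (x : 'rV[R]_n) (u v : ext R n).
Implicit Types (i j : 'I_n) (b : bool).

Local Notation W := (coef11 omega).
Local Notation M x := (invmx (coef11 omega x)).
Local Notation ip x := (super_ip (coef11 omega x)).

Definition dmetric i x : 'M[R]_n :=
  \matrix_(j, k) partial i (fun y => coef11 omega y j k) x.

Lemma posdef_omega x : posdef (W x).
Proof. exact: omega_pos. Qed.

Let Wsym x : (W x)^T = W x.
Proof. by have [] := posdef_omega x. Qed.

Let Msym x : (M x)^T = M x.
Proof. by rewrite trmx_inv Wsym. Qed.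

Lemma smooth_coef11 j k : smooth (fun y => W y j k).
Proof. by under eq_fun do rewrite mxE; exact: omega_smooth. Qed.

(** Cramer's rule, the determinant being nowhere zero. *)
Lemma smooth_invmx j k : smooth (fun y => M y j k).
Proof.
have Munit y := posdef_unitmx (posdef_omega y).
have sdet m (A : 'rV[R]_n -> 'M[R]_m) :
    (forall a c, smooth (fun y => A y a c)) -> smooth (fun y => \det (A y)).
  move=> sA; rewrite /determinant; apply: smooth_sum => s.
  apply: smoothM; first exact: smooth_cst.
  by apply: smooth_prod => a; exact: sA.
have -> : (fun y => M y j k) = (fun y => (\det (W y))^-1 * (\adj (W y)) j k).
  by apply/funext => y; rewrite /invmx Munit mxE.
apply: smoothM.
  apply: smoothV => [y|]; last by apply: sdet; exact: smooth_coef11.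
  by have := Munit y; rewrite unitmxE unitfE.
under eq_fun do rewrite mxE /cofactor.
apply: smoothM; first exact: smooth_cst.
apply: sdet => a c; have := smooth_coef11 (lift k a) (lift j c).
by congr smooth; apply/funext => y; rewrite !mxE.
Qed.

(** Differentiate M *m W = 1. *)
Lemma partial_invmx i j k x :
  partial i (fun y => M y j k) x = (- (M x *m dmetric i x *m M x)) j k.
Proof.
pose dM : 'M[R]_n := \matrix_(a, c) partial i (fun y => M y a c) x.
have h : dM *m W x + M x *m dmetric i x = 0.
  apply/matrixP => a c; rewrite !mxE -big_split /=.
  have : partial i (fun y => \sum_l M y a l * W y l c) x = 0.
    have -> : (fun y => \sum_l M y a l * W y l c) = cst ((a == c)%:R).
      apply/funext => y; have := mulVmx (posdef_unitmx (posdef_omega y)).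
      by move=> /matrixP/(_ a c); rewrite !mxE.
    by rewrite partial_cst.
  rewrite partial_sum => [|l]; last first.
    by apply: smoothM; [exact: smooth_invmx | exact: smooth_coef11].
  move=> e; rewrite -[RHS]e; apply: eq_bigr => l _.
  rewrite partialM; [|by move=> y; apply: smooth_derivable; exact: smooth_invmx
    |by move=> y; apply: smooth_derivable; exact: smooth_coef11].
  by rewrite !mxE.
have -> : - (M x *m dmetric i x *m M x) = dM; last by rewrite mxE.
move/eqP: h; rewrite addr_eq0 => /eqP h.
rewrite -mulNmx; have -> : - (M x *m dmetric i x) = dM *m W x by rewrite h.
by rewrite mulmxK // posdef_unitmx //; exact: posdef_omega.
Qed.

Lemma dmetric_tr i x : (dmetric i x)^T = dmetric i x.
Proof.
apply/matrixP => j k; rewrite !mxE; congr (partial i _ x).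
by apply/funext => y; rewrite -[in LHS](Wsym y) mxE.
Qed.

Lemma omegaE x : omega x = lefschetz (W x) (ext_one R n).
Proof. exact: bidegree11E. Qed.

Lemma wedge_omega x u : wedge (omega x) u = lefschetz (W x) u.
Proof. by rewrite omegaE wedge_lefschetz. Qed.

Lemma partial_lefschetz i alpha x : smooth_form alpha ->
  partial_form i (fun y => lefschetz (W y) (alpha y)) x =
  lefschetz (dmetric i x) (alpha x) + lefschetz (W x) (partial_form i alpha x).
Proof.
move=> sa.
pose c (p : 'I_n * 'I_n) y := W y p.1 p.2.
pose l (p : 'I_n * 'I_n) : {linear ext R n -> ext R n} :=
  creation (false, p.1) \o creation (true, p.2).
have e Y u : lefschetz Y u = \sum_p Y p.1 p.2 *: l p u.
  by rewrite /lefschetz pair_bigA.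
under eq_fun do rewrite e.
rewrite (@partial_form_comb R n _ c l) // => [|p]; last exact: smooth_coef11.
rewrite big_split /= !e; congr (_ + _).
by apply: eq_bigr => p _; rewrite mxE.
Qed.

Lemma smooth_lefschetz alpha : smooth_form alpha ->
  smooth_form (fun y => lefschetz (W y) (alpha y)).
Proof.
move=> sa.
pose c (p : 'I_n * 'I_n) y := W y p.1 p.2.
pose l (p : 'I_n * 'I_n) : {linear ext R n -> ext R n} :=
  creation (false, p.1) \o creation (true, p.2).
have e Y u : lefschetz Y u = \sum_p Y p.1 p.2 *: l p u.
  by rewrite /lefschetz pair_bigA.
under eq_fun do rewrite e.
by apply: (@smooth_form_comb R n _ c l) => // p; exact: smooth_coef11.
Qed.

Lemma smooth_form_cst u : smooth_form (fun _ : 'rV[R]_n => u).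
Proof. by move=> S; exact: smooth_cst. Qed.

Lemma partial_form_cst i u x : partial_form i (fun _ : 'rV[R]_n => u) x = 0.
Proof.
by apply/ffunP => S; rewrite !ffunE; rewrite [partial _ _]partial_cst.
Qed.

Lemma dmetric_sym x i j k : dmetric i x j k = dmetric j x i k.
Proof.
apply: (closed_symmetric (T := fun i => dmetric i x)).
rewrite -[RHS](omega_closed x) ext_dE; apply: eq_bigr => l _; congr (creation _ _).
have -> : partial_form l omega x =
    partial_form l (fun y => lefschetz (W y) (ext_one R n)) x.
  by congr (partial_form l _ x); apply/funext => y; exact: omegaE.
rewrite partial_lefschetz; last exact: smooth_form_cst.
by rewrite partial_form_cst linear0 addr0.
Qed.

(** The adjoint picked by the definition of Lambda is this one because
    super_ip is definite. *)
Lemma LambdaE alpha x :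
  Lambda omega alpha x = contraction2 false (M x) (alpha x).
Proof.
have pd := posdef_omega x; have [[ipP ipC ipos] _ _] := super_ip_spec pd.
rewrite /Lambda /adjoint.
set P := (X in xget _ X).
have Pex : P (contraction2 false (M x) (alpha x)).
  split=> // u _; rewrite wedge_omega; exact: lefschetz_adjoint.
have [_ h1] : P (xget (alpha x) P) by exact: xgetPex (ex_intro _ _ Pex).
have [_ h2] := Pex.
apply/eqP; rewrite -subr_eq0; apply: contraTT isT => /ipos.
set y := xget _ _; set z := contraction2 _ _ _.
suff -> : super_ip (W x) (y - z) (y - z) = 0 by rewrite ltxx.
have e : super_ip (W x) y (y - z) = super_ip (W x) z (y - z).
  by rewrite ipC [RHS]ipC -[LHS]h1 // -[RHS]h2.
have yz : y - z = -1 *: z + y by rewrite scaleN1r addrC.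
by rewrite [X in super_ip _ X _]yz ipP mulN1r e addNr.
Qed.

End kaehler.

Section metric_derivatives.
Context {R : realType} {n : nat}.
Variable omega : superform R n.
Hypotheses (omega_smooth : smooth_form omega) (omega11 : bidegree 1 1 omega)
  (omega_pos : positive11 omega).
Implicit Types (alpha beta : superform R n) (x : 'rV[R]_n) (u v w : ext R n).
Implicit Types (i j l : 'I_n) (b : bool).

Local Notation W := (coef11 omega).
Local Notation M x := (invmx (coef11 omega x)).
Local Notation ip x := (super_ip (coef11 omega x)).

Lemma super_ip_one x v : ip x (ext_one R n) v = vac v.
Proof.
have [[ipP ipC _] adj ip1] := super_ip_spec (omega_pos x).
have ip0 w : ip x 0 w = 0.
  by have := ipP (-1) 0 0 w; rewrite scaler0 addr0 mulN1r addNr.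
elim/(@ext_ind R n): v => [a u v hu hv||p u hu] /=.
- by rewrite ipC ipP ![super_ip _ _ (ext_one R n)]ipC hu hv /vac !ffunE.
- by rewrite ip1 vac_one.
- by rewrite ipC adj contraction_mx_one ipC ip0 vac_creation.
Qed.

Definition metric_op l x := number_op (- (dmetric omega l x *m M x)).

Lemma super_ipDr x u v w : ip x u (v + w) = ip x u v + ip x u w.
Proof.
have [[ipP ipC _] _ _] := super_ip_spec (omega_pos x).
by rewrite /= ipC -[v]scale1r ipP mul1r !scale1r ![super_ip _ _ u]ipC.
Qed.

Lemma super_ipZr x u a v : ip x u (a *: v) = a * ip x u v.
Proof.
have [[ipP ipC _] _ _] := super_ip_spec (omega_pos x).
have ip0 w : super_ip (W x) 0 w = 0.
  by have := ipP (-1) 0 0 w; rewrite scaler0 addr0 mulN1r addNr.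
by rewrite /= ipC -[a *: v]addr0 ipP ip0 addr0 ipC.
Qed.

Lemma super_ipC x u v : ip x u v = ip x v u.
Proof. by have [[_ ipC _] _ _] := super_ip_spec (omega_pos x); exact: ipC. Qed.

Lemma super_ipDl x u v w : ip x (v + w) u = ip x v u + ip x w u.
Proof. by rewrite super_ipC super_ipDr ![super_ip _ u _]super_ipC. Qed.

Lemma super_ipZl x u a v : ip x (a *: v) u = a * ip x v u.
Proof. by rewrite super_ipC super_ipZr super_ipC. Qed.

Lemma super_ip_sumr x u (I : finType) (F : I -> ext R n) :
  ip x u (\sum_k F k) = \sum_k ip x u (F k).
Proof.
have ip0 : ip x u 0 = 0 by have := super_ipZr x u 0 0; rewrite scaler0 mul0r.
by apply: (big_morph _ _ ip0) => y z; exact: super_ipDr.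
Qed.

Lemma super_ip_suml x u (I : finType) (F : I -> ext R n) :
  ip x (\sum_k F k) u = \sum_k ip x (F k) u.
Proof.
by rewrite super_ipC super_ip_sumr; apply: eq_bigr => k _; rewrite super_ipC.
Qed.

Lemma super_ip_creation x p u v :
  ip x (creation p u) v = ip x u (contraction_mx (M x) p v).
Proof. by have [_ adj _] := super_ip_spec (omega_pos x); exact: adj. Qed.

(** By induction on u: a creation operator on the left is moved to the right
    as a contraction by M. Differentiating M produces one more contraction,
    which is the commutator of the derivation with the contraction
    (contraction_mx_number_op). *)
Lemma super_ip_derivative u v :
  smooth (fun x => ip x u v) /\
  forall l x, partial l (fun y => ip y u v) x = ip x u (metric_op l x v).
Proof.
elim/(@ext_ind R n): u v => [a u1 u2 h1 h2 v||p u hu v].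
- have [s1 d1] := h1 v; have [s2 d2] := h2 v.
  have e (w : ext R n) y : ip y (a *: u1 + u2) w = a * ip y u1 w + ip y u2 w.
    by rewrite super_ipDl super_ipZl.
  under eq_fun do rewrite e.
  have s3 : smooth (fun y => a * ip y u1 v) by apply: smoothM => //; exact: smooth_cst.
  split=> [|l x]; first exact: smoothD.
  rewrite partialD; try by move=> y; exact: smooth_derivable.
  by rewrite partialZ // d1 d2 -e.
- move=> v; under eq_fun do rewrite super_ip_one.
  split=> [|l x]; first exact: smooth_cst.
  by rewrite [LHS]derive_cst super_ip_one /metric_op vac_number_op.
have e y : ip y (creation p u) v =
    \sum_k M y p.2 k * ip y u (contraction (p.1, k) v).
  rewrite super_ip_creation super_ip_sumr; apply: eq_bigr => k _.
  exact: super_ipZr.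
under eq_fun do rewrite e.
have sM k : smooth (fun y => M y p.2 k) by exact: smooth_invmx.
have sMu k : smooth (fun y => M y p.2 k * ip y u (contraction (p.1, k) v)).
  by apply: smoothM => //; case: (hu (contraction (p.1, k) v)).
split=> [|l x]; first exact: smooth_sum.
rewrite partial_sum // super_ip_creation contraction_mx_number_op.
have -> : number_op (- (dmetric omega l x *m M x)) (contraction_mx (M x) p v) =
   \sum_k M x p.2 k *: metric_op l x (contraction (p.1, k) v).
  rewrite /contraction_mx linear_sum; apply: eq_bigr => k _.
  by rewrite linearZ.
rewrite -big_split super_ip_sumr; apply: eq_bigr => k _ /=.
have [suk duk] := hu (contraction (p.1, k) v).
rewrite partialM; try by move=> y; exact: smooth_derivable.
rewrite duk super_ipDr !super_ipZr addrC; congr (_ + _ * _).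
by rewrite partial_invmx // mulmxN mulmxA.
Qed.

Lemma super_ip_expand x u v : ip x u v =
  \sum_S \sum_T u S * (v T * ip x (ext_basis R S) (ext_basis R T)).
Proof.
rewrite [in LHS](ext_basisE u) super_ip_suml.
apply: eq_bigr => S _; rewrite super_ipZl [in LHS](ext_basisE v).
by rewrite super_ip_sumr mulr_sumr; apply: eq_bigr => T _; rewrite super_ipZr.
Qed.

Lemma smooth_form_ip alpha beta : smooth_form alpha -> smooth_form beta ->
  smooth (form_ip omega alpha beta).
Proof.
move=> sa sb; rewrite /form_ip; under eq_fun do rewrite super_ip_expand.
apply: smooth_sum => S; apply: smooth_sum => T.
apply: smoothM => //; apply: smoothM => //.
exact: (super_ip_derivative _ _).1.
Qed.

Lemma partial_form_ip l alpha beta x : smooth_form alpha -> smooth_form beta ->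
  partial l (form_ip omega alpha beta) x =
  ip x (partial_form l alpha x) (beta x)
  + ip x (alpha x) (partial_form l beta x + metric_op l x (beta x)).
Proof.
move=> sa sb.
pose F S T y := alpha y S * (beta y T * ip y (ext_basis R S) (ext_basis R T)).
have sG S T : smooth (fun y => ip y (ext_basis R S) (ext_basis R T)).
  exact: (super_ip_derivative _ _).1.
have sF S T : smooth (F S T) by apply: smoothM => //; exact: smoothM.
have -> : form_ip omega alpha beta = fun y => \sum_S \sum_T F S T y.
  by apply/funext => y; exact: super_ip_expand.
rewrite partial_sum => [|S]; last by apply: smooth_sum => T; exact: sF.
under eq_bigr do (rewrite partial_sum; last by move=> T; exact: sF).
rewrite super_ipDr /=.
have -> : super_ip (W x) (alpha x) (metric_op l x (beta x)) =
    \sum_S \sum_T alpha x S * (beta x T *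
      ip x (ext_basis R S) (metric_op l x (ext_basis R T))).
  rewrite [in LHS](ext_basisE (alpha x)) super_ip_suml; apply: eq_bigr => S _.
  rewrite super_ipZl [in LHS](ext_basisE (beta x)) [metric_op _ _ _]linear_sum.
  rewrite super_ip_sumr mulr_sumr; apply: eq_bigr => T _.
  by rewrite linearZ super_ipZr.
rewrite ![super_ip (W x) _ (_ x)]super_ip_expand /=.
rewrite -!big_split /=; apply: eq_bigr => S _.
rewrite -!big_split /=; apply: eq_bigr => T _.
rewrite partialM; [|by move=> y; exact: smooth_derivable
  |by move=> y; apply: smooth_derivable; exact: smoothM].
rewrite partialM; try by move=> y; exact: smooth_derivable.
by rewrite (super_ip_derivative _ _).2 !ffunE mulrDr.
Qed.

Lemma supp_form_ip (r : R) alpha beta :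
  supp_form r beta -> supported r (form_ip omega alpha beta).
Proof.
move=> sb x rx; rewrite /form_ip sb //.
by have := super_ipZr x (alpha x) 0 0; rewrite scaler0 mul0r.
Qed.

(** The density of omega_n with respect to Lebesgue measure. *)
Definition volume x : R :=
  omega_n omega x (finset.setT, finset.setT) / vol R n (finset.setT, finset.setT).

Lemma volumeE : exists c : R, volume = fun x =>
  c * (iter n (lefschetz (W x)) (ext_one R n)) (finset.setT, finset.setT).
Proof.
exists ((n`!)%:R^-1 / vol R n (finset.setT, finset.setT)).
apply/funext => x; rewrite /volume /omega_n ffunE [LHS]mulrAC; congr (_ * _).
rewrite (@eq_iter _ _ (lefschetz (W x))) // => u.
exact: wedge_omega.
Qed.

(** By trace_op_lefschetz, trace_op obeys the same recursion in k as the
    derivative of the k-th power of omega. *)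
Lemma lefschetz_power k :
  smooth_form (fun x => iter k (lefschetz (W x)) (ext_one R n)) /\
  forall l x, partial_form l (fun x => iter k (lefschetz (W x)) (ext_one R n)) x =
    trace_op (dmetric omega l x *m M x) (iter k (lefschetz (W x)) (ext_one R n)).
Proof.
elim: k => [|k [sk dk]] /=.
  by split=> [|l x]; [exact: smooth_form_cst | rewrite partial_form_cst trace_op_one].
split=> [|l x].
  by apply: (smooth_lefschetz omega_smooth); exact: sk.
rewrite partial_lefschetz // dk trace_op_lefschetz addrC.
by rewrite mulmxKV // posdef_unitmx //; exact: omega_pos.
Qed.

Lemma smooth_volume : smooth volume.
Proof.
have [c ->] := volumeE; apply: smoothM; first exact: smooth_cst.
exact: (lefschetz_power n).1.
Qed.

(** Jacobi's formula for the density of omega_n. *)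
Lemma partial_volume l x :
  partial l volume x = \tr (M x *m dmetric omega l x) * volume x.
Proof.
have [c ->] := volumeE; have [sk dk] := lefschetz_power n.
rewrite partialZ; last exact: sk.
rewrite mulrCA; congr (_ * _).
have := congr1 (fun u : ext R n => u (finset.setT, finset.setT)) (dk l x).
by rewrite /= trace_op_top ffunE mxtrace_mulC.
Qed.

Lemma dotpE phi alpha beta : dotp omega phi alpha beta =
  integral_Rn (fun x => form_ip omega alpha beta x * expR (- phi x) * volume x).
Proof.
apply: (congr1 (@integral_Rn R n)); apply/funext => x.
by rewrite /scale_form ffunE; exact: esym (mulrA _ _ _).
Qed.

End metric_derivatives.

(** * Kaehler identities *)

Section kaehler_identities.
Context {R : realType} {n : nat}.
Variable omega : superform R n.
Hypotheses (omega_smooth : smooth_form omega) (omega11 : bidegree 1 1 omega)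
  (omega_closed : closed_form omega) (omega_pos : positive11 omega).
Implicit Types (alpha beta : superform R n) (x : 'rV[R]_n) (u v w : ext R n).
Implicit Types (i j l : 'I_n) (b : bool).

Local Notation W := (coef11 omega).
Local Notation M x := (invmx (coef11 omega x)).
Local Notation ip x := (super_ip (coef11 omega x)).

Definition contract_omega b alpha : superform R n :=
  fun x => contraction2 b (M x) (alpha x).

Lemma contraction2_pair b (Y : 'M[R]_n) u : contraction2 b Y u =
  \sum_p Y p.1 p.2 *: contraction (~~ b, p.2) (contraction (b, p.1) u).
Proof. by rewrite /contraction2 pair_bigA. Qed.

Lemma smooth_contract_omega b alpha :
  smooth_form alpha -> smooth_form (contract_omega b alpha).
Proof.
move=> sa; rewrite /contract_omega; under eq_fun do rewrite contraction2_pair.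
apply: (@smooth_form_comb R n _ (fun p x => M x p.1 p.2)
  (fun p => contraction (~~ b, p.2) \o contraction (b, p.1))) => // p.
exact: smooth_invmx.
Qed.

Lemma partial_contract_omega b alpha i x : smooth_form alpha ->
  partial_form i (contract_omega b alpha) x =
  contraction2 b (- (M x *m dmetric omega i x *m M x)) (alpha x)
  + contraction2 b (M x) (partial_form i alpha x).
Proof.
move=> sa; rewrite /contract_omega; under eq_fun do rewrite contraction2_pair.
rewrite (@partial_form_comb R n _ (fun p x => M x p.1 p.2)
  (fun p => contraction (~~ b, p.2) \o contraction (b, p.1))) // => [|p]; last first.
  exact: smooth_invmx.
rewrite big_split !contraction2_pair /=; congr (_ + _).
by apply: eq_bigr => p _; rewrite partial_invmx.
Qed.

Lemma supp_contract_omega (r : R) b alpha :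
  supp_form r alpha -> supp_form r (contract_omega b alpha).
Proof. by move=> sa x rx; rewrite /contract_omega sa // linear0. Qed.

Lemma test_contract_omega b alpha :
  test_form alpha -> test_form (contract_omega b alpha).
Proof.
move/test_formP=> [sa [r r0 ra]]; apply/test_formP.
split; first exact: smooth_contract_omega.
by exists r => //; exact: supp_contract_omega.
Qed.

(** The formal adjoint of super_d b. The two Kaehler identities carry opposite
    signs in terms of Lambda; the difference is absorbed by contraction2,
    which changes sign with its flag (contraction2_tr). *)
Definition codiff b beta : superform R n := fun x =>
  contract_omega b (super_d (~~ b) beta) x - super_d (~~ b) (contract_omega b beta) x.

Lemma test_codiff b beta : test_form beta -> test_form (codiff b beta).
Proof.
move=> tb; apply: (test_formD (beta := fun x => - super_d (~~ b) (contract_omega b beta) x)).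
  by apply: test_contract_omega; exact: test_super_d.
by apply: test_formN; apply: test_super_d; exact: test_contract_omega.
Qed.

(** Commuting Lambda with the generators leaves metric contractions of the
    derivatives of beta and a sum of zero-order terms, to which closedness of
    omega applies through kaehler_zero_order. The right-hand side is the
    adjoint of super_d b obtained by integration by parts. *)
Lemma codiffE b beta x : smooth_form beta ->
  codiff b beta x = - \sum_i (contraction_mx (M x) (b, i) (partial_form i beta x)
    + (number_op (- (dmetric omega i x *m M x)) (contraction_mx (M x) (b, i) (beta x))
       + contraction_mx (- (M x *m dmetric omega i x *m M x)) (b, i) (beta x)
       + \tr (M x *m dmetric omega i x) *: contraction_mx (M x) (b, i) (beta x))).
Proof.
move=> sb; rewrite big_split /= (kaehler_zero_order b).
- have Msym : (M x)^T = M x by rewrite trmx_inv; have [-> _] := omega_pos x.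
  rewrite /codiff {1}/contract_omega /super_d contraction2_sum.
  under [X in X - _ = _]eq_bigr do rewrite contraction2_creation //.
  under [X in _ - X = _]eq_bigr do rewrite partial_contract_omega // creationD.
  rewrite sumrB big_split /= opprD [- _ - \sum_i creation _ (contraction2 b (M x) _)]addrC.
  by rewrite addrACA subrr add0r opprD.
- by have [] := omega_pos x.
- by move=> i j k; exact: dmetric_sym.
- by move=> i; exact: dmetric_tr.
Qed.

(** In the Leibniz rule for the functions under the sum, the derivative of
    alpha gives the first term, while the derivatives of beta, of the metric
    and of the density add up to codiff by codiffE. *)
Lemma codiff_divergence b alpha beta x : smooth_form alpha -> smooth_form beta ->
  form_ip omega (super_d b alpha) beta x * volume omega x
  - form_ip omega alpha (codiff b beta) x * volume omega x =
  \sum_i partial i (fun y =>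
     form_ip omega (fun z => creation (b, i) (alpha z)) beta y * volume omega y) x.
Proof.
move=> sa sb.
have sca i : smooth_form (fun z => creation (b, i) (alpha z)).
  exact: (smooth_form_lin (creation (b, i))).
have step i : partial i (fun y =>
     form_ip omega (fun z => creation (b, i) (alpha z)) beta y * volume omega y) x =
   (ip x (creation (b, i) (partial_form i alpha x)) (beta x) +
    ip x (alpha x) (contraction_mx (M x) (b, i) (partial_form i beta x)
    + (number_op (- (dmetric omega i x *m M x)) (contraction_mx (M x) (b, i) (beta x))
       + contraction_mx (- (M x *m dmetric omega i x *m M x)) (b, i) (beta x)
       + \tr (M x *m dmetric omega i x) *: contraction_mx (M x) (b, i) (beta x))))
    * volume omega x.
  have sip := smooth_form_ip omega_smooth omega_pos (sca i) sb.
  have svol := smooth_volume omega_smooth omega11 omega_pos.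
  rewrite partialM; try by move=> y; exact: smooth_derivable.
  rewrite partial_form_ip // partial_volume // /form_ip.
  rewrite (partial_form_lin (creation (b, i))) //.
  rewrite !(super_ip_creation omega_pos) contraction_mxD contraction_mx_number_op.
  rewrite mulmxN mulmxA !(super_ipDr omega_pos) (super_ipZr omega_pos).
  by rewrite /form_ip; ring.
rewrite [RHS](eq_bigr _ (fun i _ => step i)).
rewrite -mulr_suml big_split /= -mulrBl; congr (_ * _).
rewrite /form_ip codiffE // /super_d (super_ip_suml omega_pos) -(super_ip_sumr omega_pos).
have ipN u v : ip x u (- v) = - ip x u v.
  by rewrite -scaleN1r (super_ipZr omega_pos) mulN1r.
by rewrite ipN opprK.
Qed.

Lemma codiff_adjoint b alpha beta : test_form alpha -> test_form beta ->
  integral_Rn (fun x => form_ip omega (super_d b alpha) beta x * volume omega x) =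
  integral_Rn (fun x => form_ip omega alpha (codiff b beta) x * volume omega x).
Proof.
have svol := smooth_volume omega_smooth omega11 omega_pos.
have tip a c : smooth_form a -> test_form c ->
    test_fun (fun x => form_ip omega a c x * volume omega x).
  move=> sa /test_formP[sc [r r0 rc]]; split.
    by apply: smoothM => //; exact: smooth_form_ip.
  by exists r => // x rx; rewrite (supp_form_ip omega_pos _ rc) // mul0r.
move=> ta tb; have [sa _] := ta; have [sb _] := tb.
apply/eqP; rewrite -subr_eq0 -mulN1r.
rewrite -integral_RnZ; last by apply: tip => //; exact: test_codiff.
rewrite -integral_RnD; last 2 first.
- by apply: tip => //; exact: smooth_super_d.
- have tc : test_fun (fun x => form_ip omega alpha (codiff b beta) x * volume omega x).
    by apply: tip => //; exact: test_codiff.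
  by apply: (test_funM (smooth_cst (-1)) tc).
have sca i : smooth_form (fun z => creation (b, i) (alpha z)).
  exact: (smooth_form_lin (creation (b, i))).
have -> : (fun x => form_ip omega (super_d b alpha) beta x * volume omega x +
    -1 * (form_ip omega alpha (codiff b beta) x * volume omega x)) =
  (fun x => \sum_i partial i (fun y =>
     form_ip omega (fun z => creation (b, i) (alpha z)) beta y * volume omega y) x).
  by apply/funext => x; rewrite mulN1r codiff_divergence.
rewrite integral_Rn_sum => [|i]; last by apply: test_fun_partial; exact: tip.
by rewrite big1 // => i _; apply: integral_Rn_partial; exact: tip.
Qed.

End kaehler_identities.

(** * Weights and the difference of the two Laplacians *)

Section weighted_identities.
Context {R : realType} {n : nat}.
Variables (omega : superform R n) (phi : 'rV[R]_n -> R).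
Hypotheses (omega_smooth : smooth_form omega) (omega11 : bidegree 1 1 omega)
  (omega_closed : closed_form omega) (omega_pos : positive11 omega)
  (phi_smooth : smooth phi).
Implicit Types (alpha beta gamma : superform R n) (x : 'rV[R]_n) (u v w : ext R n).
Implicit Types (i j l : 'I_n) (b c : bool).

Local Notation weight := (fun x => expR (- phi x)).
Local Notation dphi := (dsharp_phi phi).
Local Notation Lam := (contract_omega omega false).

Let smooth_weight : smooth weight.
Proof. by apply: smooth_expR; exact: smoothN. Qed.

Let weightK x : weight x * expR (phi x) = 1.
Proof. by rewrite -expRD addNr expR0. Qed.

Lemma dsharp_phi_super_d alpha x :
  dphi alpha x = expR (phi x) *: super_d true (scale_form weight alpha) x.
Proof. by rewrite /dsharp_phi /scale_form ext_dsharpE. Qed.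

(** The adjoint of d for the weighted pairing: the unweighted adjoint
    conjugated by the weight (codiff_weight). *)
Definition codiff_phi beta : superform R n :=
  fun x => Lam (dphi beta) x - dphi (Lam beta) x.

Lemma test_dsharp_phi alpha : test_form alpha -> test_form (dphi alpha).
Proof.
move=> ta; apply: test_scale; first exact: smooth_expR.
by rewrite ext_dsharpE; apply: test_super_d; exact: test_scale.
Qed.

Lemma test_codiff_phi beta : test_form beta -> test_form (codiff_phi beta).
Proof.
move=> tb; apply: (test_formD (beta := fun x => - dphi (Lam beta) x)).
  by apply: test_contract_omega => //; exact: test_dsharp_phi.
by apply: test_formN; apply: test_dsharp_phi; exact: test_contract_omega.
Qed.

Lemma codiff_weight beta x :
  codiff omega false (scale_form weight beta) x = weight x *: codiff_phi beta x.
Proof.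
rewrite /codiff /codiff_phi scalerBr !dsharp_phi_super_d scalerA weightK scale1r.
congr (_ - _).
  rewrite /contract_omega dsharp_phi_super_d -linearZ /= scalerA weightK scale1r.
  by [].
congr (super_d true _ x); apply/funext => y.
by rewrite /contract_omega /scale_form linearZ.
Qed.

Lemma dotpP alpha beta : dotp omega phi alpha beta =
  integral_Rn (fun x => form_ip omega alpha beta x * weight x * volume omega x).
Proof. exact: dotpE. Qed.

Lemma ext_d_adjoint alpha beta : test_form alpha -> test_form beta ->
  dotp omega phi (ext_d alpha) beta = dotp omega phi alpha (codiff_phi beta).
Proof.
move=> ta tb; rewrite !dotpP ext_dE.
have := codiff_adjoint omega_smooth omega11 omega_closed omega_pos false ta
  (test_scale smooth_weight tb).
have e1 : (fun x => form_ip omega (super_d false alpha) (scale_form weight beta) x * volume omega x)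
   = (fun x => form_ip omega (super_d false alpha) beta x * weight x * volume omega x).
  by apply/funext => x; rewrite /form_ip (super_ipZr omega_pos) [weight x * _]mulrC.
have e2 : (fun x => form_ip omega alpha (codiff omega false (scale_form weight beta)) x * volume omega x)
   = (fun x => form_ip omega alpha (codiff_phi beta) x * weight x * volume omega x).
  by apply/funext => x; rewrite /form_ip codiff_weight (super_ipZr omega_pos) [weight x * _]mulrC.
by rewrite e1 e2.
Qed.

(** Twisting d# compensates the weight of the pairing, hence an adjoint that
    does not depend on phi. *)
Lemma dsharp_phi_adjoint alpha beta : test_form alpha -> test_form beta ->
  dotp omega phi (dphi alpha) beta = dotp omega phi alpha (codiff omega true beta).
Proof.
move=> ta tb; rewrite !dotpP.
have := codiff_adjoint omega_smooth omega11 omega_closed omega_pos true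
  (test_scale smooth_weight ta) tb.
have e1 : (fun x => form_ip omega (super_d true (scale_form weight alpha)) beta x * volume omega x)
   = (fun x => form_ip omega (dphi alpha) beta x * weight x * volume omega x).
  apply/funext => x; rewrite /form_ip dsharp_phi_super_d (super_ipZl omega_pos).
  by rewrite [expR (phi x) * _]mulrC -[_ * _ * weight x]mulrA [expR (phi x) * _]mulrC weightK mulr1.
have e2 : (fun x => form_ip omega (scale_form weight alpha) (codiff omega true beta) x * volume omega x)
   = (fun x => form_ip omega alpha (codiff omega true beta) x * weight x * volume omega x).
  by apply/funext => x; rewrite /form_ip (super_ipZl omega_pos) [weight x * _]mulrC.
by rewrite e1 e2.
Qed.

Lemma dotpC alpha beta : dotp omega phi alpha beta = dotp omega phi beta alpha.
Proof.
rewrite !dotpP; congr (integral_Rn _); apply/funext => x.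
by rewrite /form_ip (super_ipC omega_pos).
Qed.

Lemma test_dotp_integrand alpha beta : test_form alpha -> test_form beta ->
  test_fun (fun x => form_ip omega alpha beta x * weight x * volume omega x).
Proof.
move=> [sa _] /test_formP[sb [r r0 rb]]; split.
  apply: smoothM; last exact: smooth_volume.
  by apply: smoothM => //; exact: smooth_form_ip.
by exists r => // x rx; rewrite (supp_form_ip omega_pos _ rb) // !mul0r.
Qed.

Lemma dotpDl alpha gamma beta : test_form alpha -> test_form gamma -> test_form beta ->
  dotp omega phi (fun x => alpha x + gamma x) beta =
  dotp omega phi alpha beta + dotp omega phi gamma beta.
Proof.
move=> ta tg tb; rewrite !dotpP -integral_RnD; try exact: test_dotp_integrand.
congr (integral_Rn _); apply/funext => x.
by rewrite {1}/form_ip (super_ipDl omega_pos) !mulrDl.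
Qed.

(** Two test forms with equal pairings against all test forms have equal
    norms, so the norm does not depend on which adjoint is picked. *)
Lemma normsq_form_adjoint (A : superform R n -> superform R n) alpha beta :
  test_form beta ->
  (forall gamma, test_form gamma ->
     dotp omega phi (A gamma) alpha = dotp omega phi gamma beta) ->
  normsq omega phi (form_adjoint omega phi A alpha) = normsq omega phi beta.
Proof.
move=> tb hb; rewrite /form_adjoint /adjoint; set P := (X in xget _ X).
have [tc hc] : P (xget alpha P) by apply: xgetPex; exists beta.
set c := xget _ _ in tc hc *.
rewrite /normsq; apply: etrans (esym (hc c tc)) _; apply: etrans (hb c tc) _.
apply: etrans (dotpC _ _) _; apply: etrans (esym (hc beta tb)) _; exact: hb.
Qed.

Lemma super_dD b alpha gamma x : smooth_form alpha -> smooth_form gamma ->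
  super_d b (fun y => alpha y + gamma y) x = super_d b alpha x + super_d b gamma x.
Proof.
move=> sa sg; rewrite /super_d -big_split; apply: eq_bigr => i _ /=.
by rewrite partial_formD // creationD.
Qed.

Lemma super_dN b alpha x : smooth_form alpha ->
  super_d b (fun y => - alpha y) x = - super_d b alpha x.
Proof.
move=> sa; rewrite /super_d -sumrN; apply: eq_bigr => i _ /=.
by rewrite partial_formN // creationN.
Qed.

(** Symmetric second derivatives meet anticommuting generators. *)
Lemma super_d_anticommute b c gamma x : smooth_form gamma ->
  super_d b (super_d c gamma) x = - super_d c (super_d b gamma) x.
Proof.
move=> sg.
have e b1 b2 : super_d b1 (super_d b2 gamma) x = \sum_i \sum_j
    creation (b1, i) (creation (b2, j) (partial_form i (partial_form j gamma) x)).
  apply: eq_bigr => i _; rewrite -creation_sum; congr (creation _ _).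
  have sc j : smooth_form (fun y => creation (b2, j) (partial_form j gamma y)).
    by apply: (smooth_form_lin (creation (b2, j))); exact: smooth_partial_form.
  rewrite /super_d partial_form_sum //; apply: eq_bigr => j _.
  by rewrite (partial_form_lin (creation (b2, j))) //; exact: smooth_partial_form.
have comm k l : partial_form k (partial_form l gamma) x =
    partial_form l (partial_form k gamma) x.
  apply/ffunP => S; rewrite [LHS]ffunE [RHS]ffunE.
  have e2 m : (fun y => partial_form m gamma y S) = partial m (fun y => gamma y S).
    by apply/funext => y; rewrite ffunE.
  apply: etrans (congr1 (fun F => partial k F x) (e2 l)) _.
  apply: etrans _ (congr1 (fun F => partial l F x) (esym (e2 k))).
  exact: (congr1 (fun F => F x) (partialC k l (sg S))).
rewrite !e exchange_big -sumrN; apply: eq_bigr => i _ /=.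
by rewrite -sumrN; apply: eq_bigr => j _; rewrite creationC (comm j i).
Qed.

Definition hessian x : 'M[R]_n := \matrix_(i, j) partial i (partial j phi) x.

(** Exterior multiplication by d# phi. *)
Definition wedge_dsharp gamma : superform R n :=
  fun x => \sum_j partial j phi x *: creation (true, j) (gamma x).

Lemma smooth_wedge_dsharp gamma : smooth_form gamma -> smooth_form (wedge_dsharp gamma).
Proof.
move=> sg; apply: (@smooth_form_comb R n _ (fun j => partial j phi)
  (fun j => creation (true, j))) => // j.
exact: smooth_partial.
Qed.

Lemma dsharp_phiE gamma x : smooth_form gamma ->
  dphi gamma x = super_d true gamma x - wedge_dsharp gamma x.
Proof.
move=> sg; rewrite dsharp_phi_super_d /super_d /wedge_dsharp scaler_sumr -sumrB.
apply: eq_bigr => j _; rewrite partial_form_scale //.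
have -> : partial j weight x = - (weight x * partial j phi x).
  rewrite partial_expR => [|y]; last first.
    by apply: smooth_derivable; exact: smoothN.
  by rewrite partialN // mulrN.
rewrite creationD !creationZ scalerDr !scalerA mulrN mulrA ![expR (phi x) * _]mulrC.
by rewrite weightK mul1r scale1r scaleNr addrC.
Qed.

Lemma smooth_dsharp_phi gamma : smooth_form gamma -> smooth_form (dphi gamma).
Proof.
move=> sg; apply: smooth_form_scale; first exact: smooth_expR.
by rewrite ext_dsharpE; apply: smooth_super_d; exact: smooth_form_scale.
Qed.

Lemma ddsharpE x : ddsharp phi x = lefschetz (hessian x) (ext_one R n).
Proof.
rewrite /ddsharp ext_dE ext_dsharpE.
have -> : super_d true (form0 phi) = wedge_dsharp (fun=> ext_one R n).
  apply/funext => y; apply: eq_bigr => j _.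
  rewrite (partial_form_scale (alpha := fun=> ext_one R n)) //; last exact: smooth_form_cst.
  by rewrite partial_form_cst scaler0 addr0 creationZ.
rewrite /super_d /lefschetz; apply: eq_bigr => i _.
rewrite (@partial_form_comb R n _ (fun j => partial j phi)
  (fun j => creation (true, j)) (fun=> ext_one R n)) => [|j|]; last 2 first.
- exact: smooth_partial.
- exact: smooth_form_cst.
rewrite creation_sum; apply: eq_bigr => j _.
by rewrite partial_form_cst linear0 scaler0 addr0 creationZ mxE.
Qed.

(** The second-order part vanishes by anticommutation and the first-order
    terms cancel, which leaves the Hessian of phi. *)
Lemma super_d_dsharp_phi gamma x : smooth_form gamma ->
  super_d false (dphi gamma) x + dphi (super_d false gamma) x =
  - wedge (ddsharp phi x) (gamma x).
Proof.
move=> sg; rewrite ddsharpE wedge_lefschetz.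
have sd b := smooth_super_d b sg.
rewrite (dsharp_phiE _ (sd false)).
have -> : dphi gamma = (fun y => super_d true gamma y + - wedge_dsharp gamma y).
  by apply/funext => y; exact: dsharp_phiE.
have sw := smooth_wedge_dsharp sg.
rewrite (super_dD false x (sd true) (smooth_formN sw)) super_dN // (super_d_anticommute false true) //.
rewrite addrACA addNr add0r -opprD; congr (- _).
have dw i : partial_form i (wedge_dsharp gamma) x =
    \sum_j (hessian x i j *: creation (true, j) (gamma x)
           + partial j phi x *: creation (true, j) (partial_form i gamma x)).
  rewrite (@partial_form_comb R n _ (fun j => partial j phi)
    (fun j => creation (true, j)) gamma (fun j => smooth_partial j phi_smooth) sg).
  by apply: eq_bigr => j _; rewrite mxE.
have -> : wedge_dsharp (super_d false gamma) x = - \sum_i \sum_j partial j phi x *: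
    creation (false, i) (creation (true, j) (partial_form i gamma x)).
  rewrite exchange_big -sumrN; apply: eq_bigr => j _ /=.
  rewrite /super_d creation_sum scaler_sumr -sumrN; apply: eq_bigr => i _.
  by rewrite creationC scalerN.
apply/eqP; rewrite subr_eq; apply/eqP; rewrite /lefschetz -big_split.
apply: eq_bigr => i _ /=; rewrite dw creation_sum -big_split.
by apply: eq_bigr => j _ /=; rewrite creationD !creationZ.
Qed.

Lemma dsharp_phiD alpha gamma x : smooth_form alpha -> smooth_form gamma ->
  dphi (fun y => alpha y + gamma y) x = dphi alpha x + dphi gamma x.
Proof.
move=> sa sg; rewrite !dsharp_phi_super_d -scalerDr -super_dD //; try exact: smooth_form_scale.
congr (_ *: super_d true _ x); apply/funext => y.
by rewrite /scale_form scalerDr.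
Qed.

Lemma dsharp_phiN alpha x : smooth_form alpha ->
  dphi (fun y => - alpha y) x = - dphi alpha x.
Proof.
move=> sa; rewrite !dsharp_phi_super_d -scalerN -super_dN; last exact: smooth_form_scale.
congr (_ *: super_d true _ x); apply/funext => y.
by rewrite /scale_form scalerN.
Qed.

Let regroup (a1 b1 c1 d1 e1 f1 : ext R n) :
  a1 - b1 + (c1 - d1) = - d1 + e1 + (- f1 + a1) + (f1 + c1 - (b1 + e1)).
Proof.
apply/ffunP => S; rewrite !ffunE.
have h (r1 r2 r3 r4 r5 r6 : R) : r1 - r2 + (r3 - r4) =
      - r4 + r5 + (- r6 + r1) + (r6 + r3 - (r2 + r5)) by ring.
exact: h.
Qed.

(** Both Laplacians expand into products of Lambda, d and d#_phi. The products
    with Lambda in the middle occur on both sides; the others assemble into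
    the commutator of Lambda with the anticommutator of d and d#_phi. *)
Lemma laplacian_commutator alpha x : smooth_form alpha ->
  super_d false (codiff_phi alpha) x + codiff_phi (super_d false alpha) x =
  dphi (codiff omega true alpha) x + codiff omega true (dphi alpha) x
  + commutator_Lambda omega (ddsharp phi) alpha x.
Proof.
move=> sa.
have LamN beta : contract_omega omega true beta = (fun y => - Lam beta y).
  apply/funext => y; rewrite /contract_omega (contraction2_tr false) //.
  by rewrite trmx_inv; have [-> _] := omega_pos y.
have sL beta : smooth_form beta -> smooth_form (Lam beta).
  exact: smooth_contract_omega.
have sd := smooth_super_d false sa; have ss := smooth_dsharp_phi sa.
have sLa := sL _ sa; have sLs := sL _ ss; have sLd := sL _ sd.
have -> : commutator_Lambda omega (ddsharp phi) alpha x =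
    Lam (fun y => super_d false (dphi alpha) y + dphi (super_d false alpha) y) x
    - (super_d false (dphi (Lam alpha)) x + dphi (super_d false (Lam alpha)) x).
  have e1 := super_d_dsharp_phi x sLa.
  have e2 : (fun y => super_d false (dphi alpha) y + dphi (super_d false alpha) y) =
      (fun y => - wedge (ddsharp phi y) (alpha y)).
    by apply/funext => y; exact: super_d_dsharp_phi.
  apply: etrans _ (congr2 (fun a z => Lam a x - z) (esym e2) (esym e1)).
  have e3 := LambdaE omega11 omega_pos alpha x.
  have e4 := LambdaE omega11 omega_pos (wedge_form (ddsharp phi) alpha) x.
  apply: etrans (congr2 (fun a z => wedge (ddsharp phi x) a - z) e3 e4) _.
  by rewrite /contract_omega [in RHS]linearN /= opprK [RHS]addrC.
have -> : codiff omega true alpha =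
    (fun y => - Lam (super_d false alpha) y + super_d false (Lam alpha) y).
  apply/funext => y; rewrite /codiff /= !LamN; congr (_ + _).
  by rewrite super_dN // opprK.
have -> : codiff omega true (dphi alpha) x =
    - Lam (super_d false (dphi alpha)) x + super_d false (Lam (dphi alpha)) x.
  by rewrite /codiff /= !LamN super_dN // opprK.
rewrite dsharp_phiD //; [|exact: smooth_formN|exact: smooth_super_d].
rewrite dsharp_phiN // {1}/codiff_phi.
rewrite (super_dD false x sLs (smooth_formN (smooth_dsharp_phi sLa))) super_dN; last first.
  exact: smooth_dsharp_phi.
rewrite /codiff_phi.
have -> : Lam (fun y => super_d false (dphi alpha) y + dphi (super_d false alpha) y) x =
   Lam (super_d false (dphi alpha)) x + Lam (dphi (super_d false alpha)) x.
  by rewrite /contract_omega linearD.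
exact: regroup.
Qed.

End weighted_identities.

Theorem theorem5p9 (R : realType) (n : nat) (omega : superform R n)
    (phi : 'rV[R]_n -> R)
    (omega_smooth : smooth_form omega) (omega11 : bidegree 1 1 omega)
    (omega_closed : closed_form omega) (omega_pos : positive11 omega)
    (phi_smooth : smooth phi)
    (alpha : superform R n) (alpha_test : test_form alpha) :
  normsq omega phi (form_adjoint omega phi (@ext_d R n) alpha)
    + normsq omega phi (ext_d alpha)
  = normsq omega phi (form_adjoint omega phi (dsharp_phi phi) alpha)
    + normsq omega phi (dsharp_phi phi alpha)
    + dotp omega phi (commutator_Lambda omega (ddsharp phi) alpha) alpha.
Proof.
set dphi := dsharp_phi phi; set delta := codiff_phi omega phi.
pose codiff_sharp := codiff omega true.
have td (beta : superform R n) : test_form beta -> test_form (ext_d beta).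
  by rewrite ext_dE; exact: test_super_d.
have ts (beta : superform R n) : test_form beta -> test_form (dphi beta).
  exact: test_dsharp_phi.
have tdelta (beta : superform R n) : test_form beta -> test_form (delta beta).
  exact: test_codiff_phi.
have tsharp (beta : superform R n) : test_form beta -> test_form (codiff_sharp beta).
  exact: test_codiff.
have adj1 beta gamma : test_form beta -> test_form gamma ->
    dotp omega phi (ext_d beta) gamma = dotp omega phi beta (delta gamma).
  exact: ext_d_adjoint.
have adj2 beta gamma : test_form beta -> test_form gamma ->
    dotp omega phi (dphi beta) gamma = dotp omega phi beta (codiff_sharp gamma).
  exact: dsharp_phi_adjoint.
have sym beta gamma : dotp omega phi beta gamma = dotp omega phi gamma beta.
  exact: dotpC.
have add beta gamma : test_form beta -> test_form gamma ->
    dotp omega phi (fun x => beta x + gamma x) alpha =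
    dotp omega phi beta alpha + dotp omega phi gamma alpha.
  by move=> tb tg; exact: dotpDl.
have n1 : normsq omega phi (form_adjoint omega phi (@ext_d R n) alpha) =
    dotp omega phi (ext_d (delta alpha)) alpha.
  apply: etrans (normsq_form_adjoint omega_pos (tdelta _ alpha_test) _) _.
    by move=> gamma tg; exact: adj1.
  exact: esym (adj1 _ _ (tdelta _ alpha_test) alpha_test).
have n2 : normsq omega phi (ext_d alpha) = dotp omega phi (delta (ext_d alpha)) alpha.
  by rewrite /normsq; apply: etrans (adj1 _ _ alpha_test (td _ alpha_test)) _; exact: sym.
have n3 : normsq omega phi (form_adjoint omega phi dphi alpha) =
    dotp omega phi (dphi (codiff_sharp alpha)) alpha.
  apply: etrans (normsq_form_adjoint omega_pos (tsharp _ alpha_test) _) _.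
    by move=> gamma tg; exact: adj2.
  exact: esym (adj2 _ _ (tsharp _ alpha_test) alpha_test).
have n4 : normsq omega phi (dphi alpha) =
    dotp omega phi (codiff_sharp (dphi alpha)) alpha.
  by rewrite /normsq; apply: etrans (adj2 _ _ alpha_test (ts _ alpha_test)) _; exact: sym.
pose X x := ext_d (delta alpha) x + delta (ext_d alpha) x.
pose Y x := dphi (codiff_sharp alpha) x + codiff_sharp (dphi alpha) x.
have hX : dotp omega phi X alpha = dotp omega phi (ext_d (delta alpha)) alpha
    + dotp omega phi (delta (ext_d alpha)) alpha.
  by apply: add; [apply: td; exact: tdelta | apply: tdelta; exact: td].
have hY : dotp omega phi Y alpha = dotp omega phi (dphi (codiff_sharp alpha)) alpha
    + dotp omega phi (codiff_sharp (dphi alpha)) alpha.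
  by apply: add; [apply: ts; exact: tsharp | apply: tsharp; exact: ts].
have tX : test_form X.
  by apply: test_formD; [apply: td; exact: tdelta | apply: tdelta; exact: td].
have tY : test_form Y.
  by apply: test_formD; [apply: ts; exact: tsharp | apply: tsharp; exact: ts].
have XY : X = (fun x => Y x + commutator_Lambda omega (ddsharp phi) alpha x).
  apply/funext => x.
  have h := laplacian_commutator omega_smooth omega11 omega_pos
    phi_smooth x alpha_test.1.
  rewrite -(ext_dE alpha) -(ext_dE (codiff_phi omega phi alpha)) in h; exact: h.
have tC : test_form (commutator_Lambda omega (ddsharp phi) alpha).
  have -> : commutator_Lambda omega (ddsharp phi) alpha = (fun x => X x + - Y x).
    by apply/funext => x; rewrite XY addrAC subrr add0r.
  exact: (test_formD tX (test_formN tY)).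
have hXY := etrans (congr1 (fun F => dotp omega phi F alpha) XY)
  (dotpDl omega_smooth omega11 omega_pos phi_smooth tY tC alpha_test).
have hl := etrans (congr2 +%R n1 n2) (esym hX).
have hr := etrans (congr2 +%R n3 n4) (esym hY).
apply: etrans hl (etrans hXY _).
exact: (congr1 (fun a => a + dotp omega phi
  (commutator_Lambda omega (ddsharp phi) alpha) alpha) (esym hr)).
Qed.
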